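(* Let $n\ge 1$, let $\lambda$ be an $n$-partition, let $\pi\in S_n^\lambda$, and let $T$ be a semistandard tableau of shape $\lambda$. Then $T$ is an exact Demazure tableau at $\pi$ (that is, $R(T)=Y_\lambda(\pi)$) if and only if $T(l,k)\in C_\lambda(T,\pi;l,k)$ for all $(l,k)\in\lambda$.
   Context: Notation. Fix $n\ge 1$. For integers $p,q$, $[p,q]=\{p,p+1,\dots,q\}$ (empty if $p>q$). An $n$-partition is $\lambda=(\lambda_1\ge\dots\ge\lambda_n\ge 0)$, integers. Its shape has $\lambda_i$ left-justified boxes in row $i$ (row 1 at the top). The box in column $j$ and row $i$ is written $(j,i)\in\lambda$ (column index first). The column lengths are $\zeta_1,\dots,\zeta_{\lambda_1}$. A semistandard tableau $T$ of shape $\lambda$ is a filling with values $T(j,i)\in[1,n]$ such that $T(j,i)\le T(j+1,i)$ and $T(j,i)<T(j,i+1)$; $\mathcal{T}_\lambda$ is the set of these. Boundary conventions: $T(l+1,k):=n$ if $l=\lambda_k$; $T(l,k+1):=n+1$ if $k=\zeta_l$. $m(T)$ is the maximum of the values at the bottoms of the columns of $T$ (equivalently the maximum value of $T$); for the empty tableau, $m:=1$. Permutations and keys. $S_n$ is the set of $n$-tuples $\pi=(\pi_1,\dots,\pi_n)$ with distinct entries from $[1,n]$. Let $q_1<\dots<q_r$ be the distinct column lengths of $\lambda$, $q_0:=0$, $q_{r+1}:=n$. $S_n^\lambda$ is the set of $\pi\in S_n$ such that $\pi_i<\pi_j$ whenever $i<j$ both lie in $[q_{s-1}+1,q_s]$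 for some $1\le s\le r+1$. The $\lambda$-key $Y=Y_\lambda(\pi)$ is the tableau of shape $\lambda$ whose $j$th column consists of $\pi_1,\dots,\pi_{\zeta_j}$ sorted increasingly from top to bottom, with entries $Y(j,i)$. Right key. For $T\in\mathcal{T}_\lambda$ and each $j$, there is a semistandard skew tableau that rectifies (by jeu de taquin) to $T$, whose column lengths are a rearrangement of $\zeta_1,\dots,\zeta_{\lambda_1}$, and whose rightmost column has length $\zeta_j$; the rightmost column depends only on $T$ and its length $\zeta_j$. The right key $R(T)\in\mathcal{T}_\lambda$ is the tableau whose $j$th column is this rightmost column. Scanning. The earliest weakly increasing subsequence (EWIS) of a sequence $(x_1,x_2,\dots)$ is $(x_{i_1},x_{i_2},\dots)$ with $i_1=1$ and, for $j>1$, $i_j$ minimal with $i_j>i_{j-1}$ and $x_{i_{j-1}}\le x_{i_j}$. For $1\le l\le\lambda_1$, let $T^{(l,\zeta_l)}$ be $T$ with its first $l-1$ columns removed (column indexing retained). For $k=\zeta_l,\zeta_l-1,\dots,1$: read the bottom values of the nonempty columns of $T^{(l,k)}$ from left to right (starting with column $l$, whose bottom is at $(l,k)$), take the EWIS of this sequence, and let the scanning path $P(T;l,k)$ be the sequence of locations of this EWIS; then let $T^{(l,k-1)}$ be the (semistandard) tableau obtained from $T^{(l,k)}$ by removing the boxes of $P(T;l,k)$. Let $U^{(l,k)}$ be $T^{(l,k)}$ with its leftmost remaining column (column $l$) removed. The sets $C$. Let $(l,k)\in\lambda$. If $l=\lambda_1$, then $C_\lambda(T,\pi;l,k):=\{Y(l,k)\}$.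 If $1\le l<\lambda_1$, write $U=U^{(l,k)}$. If $m(U)>Y(l,k)$, then $C_\lambda(T,\pi;l,k):=\emptyset$. If $m(U)=Y(l,k)$, then $C_\lambda(T,\pi;l,k):=[k,\min\{Y(l,k),T(l,k+1)-1,T(l+1,k)\}]$. If $m(U)<Y(l,k)$, then $C_\lambda(T,\pi;l,k):=\{Y(l,k)\}\cap[k,\min\{T(l,k+1)-1,T(l+1,k)\}]$. *)

(* Defs.v *)
(* MathComp.  All indices are 1-based, and a box is given by its column index
   first, its row index second. *)
From mathcomp Require Import all_boot.

Set Implicit Arguments.
Unset Strict Implicit.
Unset Printing Implicit Defensive.

(** Partitions and shapes *)

Definition is_partition (mu : seq nat) : Prop := sorted geq mu.

Definition row_len (mu : seq nat) (i : nat) : nat := nth 0 mu i.-1.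

Definition col_len (mu : seq nat) (j : nat) : nat := count (leq j) mu.

Definition ncols (mu : seq nat) : nat := row_len mu 1.

Definition col_lens (mu : seq nat) : seq nat :=
  [seq col_len mu j | j <- iota 1 (ncols mu)].

Definition box (mu : seq nat) (j i : nat) : bool :=
  [&& 0 < j, 0 < i & j <= row_len mu i].

(** Tableaux *)

(* Only the values at the boxes of the shape under consideration matter. *)
Definition filling := nat -> nat -> nat.

Definition semistandard_on (n : nat) (B : nat -> nat -> bool) (T : filling) : Prop :=
  [/\ forall j i, B j i -> 1 <= T j i <= n,
      forall j i, B j i -> B j.+1 i -> T j i <= T j.+1 i
    & forall j i, B j i -> B j i.+1 -> T j i < T j i.+1].

Definition semistandard (n : nat) (lam : seq nat) (T : filling) : Prop :=
  semistandard_on n (box lam) T.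

(** Permutations and keys *)

Definition is_permutation (n : nat) (pi : n.-tuple nat) : Prop :=
  uniq pi /\ all (fun x => 1 <= x <= n) pi.

(* [:: q_0; q_1; ...; q_r; q_(r+1)] *)
Definition breaks (n : nat) (lam : seq nat) : seq nat :=
  0 :: rcons (sort leq (undup (col_lens lam))) n.

Definition in_S_lam (n : nat) (lam : seq nat) (pi : n.-tuple nat) : Prop :=
  is_permutation pi /\
  forall s i j, 1 <= s -> s < size (breaks n lam) -> i < j ->
    (nth 0 (breaks n lam) s.-1).+1 <= i <= nth 0 (breaks n lam) s ->
    (nth 0 (breaks n lam) s.-1).+1 <= j <= nth 0 (breaks n lam) s ->
    nth 0 pi i.-1 < nth 0 pi j.-1.

Definition key (lam pi : seq nat) : filling :=
  fun j i => nth 0 (sort leq (take (col_len lam j) pi)) i.-1.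

(** Jeu de taquin on skew tableaux *)

Record skew_filling := Skew {
  inner : seq nat;
  outer : seq nat;
  entry : filling }.

Definition skew_box (S : skew_filling) (j i : nat) : bool :=
  box (outer S) j i && ~~ box (inner S) j i.

Definition semistandard_skew (n : nat) (S : skew_filling) : Prop :=
  [/\ is_partition (inner S), is_partition (outer S),
      forall i, row_len (inner S) i <= row_len (outer S) i
    & semistandard_on n (skew_box S) (entry S)].

Definition skew_col_len (S : skew_filling) (j : nat) : nat :=
  col_len (outer S) j - col_len (inner S) j.

Definition skew_col_lens (S : skew_filling) : seq nat :=
  [seq skew_col_len S j | j <- iota 1 (ncols (outer S))].

(* The i-th entry from the top of the rightmost column. *)
Definition last_col (S : skew_filling) (i : nat) : nat :=
  let c := ncols (outer S) in entry S c (col_len (inner S) c + i).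

Definition update (f : filling) (j i v : nat) : filling :=
  fun j' i' => if (j' == j) && (i' == i) then v else f j' i'.

(* [slide nu f j i f' j' i']: a hole at (j, i), in the filling f of outer shape
   nu, travels to (j', i') and leaves the filling f'.  If the neighbours to the
   right and below are equal, then the one below moves. *)
Inductive slide (nu : seq nat) :
    filling -> nat -> nat -> filling -> nat -> nat -> Prop :=
| slide_stop f j i :
    ~~ box nu j.+1 i -> ~~ box nu j i.+1 -> slide nu f j i f j i
| slide_below f j i f' j' i' :
    box nu j i.+1 -> (box nu j.+1 i -> f j i.+1 <= f j.+1 i) ->
    slide nu (update f j i (f j i.+1)) j i.+1 f' j' i' ->
    slide nu f j i f' j' i'
| slide_right f j i f' j' i' :
    box nu j.+1 i -> (box nu j i.+1 -> f j.+1 i < f j i.+1) ->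
    slide nu (update f j i (f j.+1 i)) j.+1 i f' j' i' ->
    slide nu f j i f' j' i'.

Definition shorten_row (mu : seq nat) (i : nat) : seq nat :=
  set_nth 0 mu i.-1 (row_len mu i).-1.

(* One slide, into the inner corner at the end of row i of the inner shape. *)
Definition jdt_step (S S' : skew_filling) : Prop :=
  exists i f' j' i',
    [/\ 0 < i, row_len (inner S) i.+1 < row_len (inner S) i,
        slide (outer S) (entry S) (row_len (inner S) i) i f' j' i'
      & S' = Skew (shorten_row (inner S) i) (shorten_row (outer S) i') f'].

Definition is_straight (lam : seq nat) (T : filling) (S : skew_filling) : Prop :=
  [/\ forall j i, ~~ box (inner S) j i,
      forall j i, box (outer S) j i = box lam j i
    & forall j i, box lam j i -> entry S j i = T j i].

Inductive rectifies_to (lam : seq nat) (T : filling) : skew_filling -> Prop :=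
| rectifies_done S : is_straight lam T S -> rectifies_to lam T S
| rectifies_step S S' :
    jdt_step S S' -> rectifies_to lam T S' -> rectifies_to lam T S.

(** The right key, as a relation between T and R *)

Definition is_right_key (n : nat) (lam : seq nat) (T R : filling) : Prop :=
  semistandard n lam R /\
  forall j, 1 <= j <= ncols lam ->
    exists S : skew_filling,
      [/\ semistandard_skew n S,
          rectifies_to lam T S,
          perm_eq (skew_col_lens S) (col_lens lam),
          skew_col_len S (ncols (outer S)) = col_len lam j
        & forall i, 1 <= i <= col_len lam j -> R j i = last_col S i].

Definition exact_demazure (n : nat) (lam pi : seq nat) (T : filling) : Prop :=
  is_right_key n lam T (key lam pi).

(** Scanning *)

(* The sequence is x_a = v a for a in s; the result lists the chosen a. *)
Fixpoint ewis_after (A : Type) (v : A -> nat) (x : nat) (s : seq A) : seq A :=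
  if s is a :: s' then
    if x <= v a then a :: ewis_after v (v a) s' else ewis_after v x s'
  else [::].

Definition ewis (A : Type) (v : A -> nat) (s : seq A) : seq A :=
  if s is a :: s' then a :: ewis_after v (v a) s' else [::].

(* During scanning boxes are only removed from column bottoms, so what remains
   of T is given by the heights h j of its columns. *)
Definition bottoms (lam : seq nat) (l : nat) (h : nat -> nat) : seq (nat * nat) :=
  [seq (j, h j) | j <- iota l ((ncols lam).+1 - l) & 0 < h j].

Definition value_at (T : filling) (b : nat * nat) : nat := T b.1 b.2.

Definition scan_path (lam : seq nat) (T : filling) (l : nat) (h : nat -> nat) :
    seq (nat * nat) :=
  ewis (value_at T) (bottoms lam l h).

Definition remove_path (lam : seq nat) (T : filling) (l : nat) (h : nat -> nat) :
    nat -> nat :=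
  fun j => if (j, h j) \in scan_path lam T l h then (h j).-1 else h j.

(* Column heights of T^(l,k); only the columns from l on are relevant. *)
Definition heights (lam : seq nat) (T : filling) (l k : nat) : nat -> nat :=
  iter (col_len lam l - k) (remove_path lam T l) (col_len lam).

(* m(U^(l,k)) *)
Definition m_U (lam : seq nat) (T : filling) (l k : nat) : nat :=
  let bs := bottoms lam l.+1 (heights lam T l k) in
  if bs is [::] then 1 else \max_(b <- bs) value_at T b.

(** The sets C *)

(* T(l+1, k) and T(l, k+1), with the boundary conventions *)
Definition right_value (n : nat) (lam : seq nat) (T : filling) (l k : nat) : nat :=
  if l == row_len lam k then n else T l.+1 k.

Definition below_value (n : nat) (lam : seq nat) (T : filling) (l k : nat) : nat :=
  if k == col_len lam l then n.+1 else T l k.+1.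

Definition C_set (n : nat) (lam pi : seq nat) (T : filling) (l k : nat) : pred nat :=
  let Y := key lam pi l k in
  let m := m_U lam T l k in
  let bound := minn (below_value n lam T l k - 1) (right_value n lam T l k) in
  if l == ncols lam then pred1 Y
  else if Y < m then pred0
  else if m == Y then [pred x | k <= x <= minn Y bound]
  else [pred x | (x == Y) && (k <= x <= bound)].

(* Main.v *)
(* Write a tableau as the word of its columns, each read upwards, and fix d.  The
   largest size of d disjoint weakly increasing subsequences of a word is
   invariant under Knuth relations, hence under jeu de taquin.  A strictly
   decreasing column meets each subsequence at most once, so this size is at most
   the sum of the numbers min(d, column length); for a tableau of straight shape
   the bound is attained by the first d rows.  If the columns of a skew tableau
   are rearranged and the last one, C, has length d, then a maximal family must
   use all of C, that is, it ends exactly in C; appending a second copy of C still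
   gains d.  Comparing two such skew tableaux with the same rectification shows
   that their last columns bound each other, so they agree.
   One such skew tableau is obtained from T by exchanging column l successively
   with the columns to its right, which is what scanning does: an earliest weakly
   increasing subsequence ends in the maximum of the sequence, so the entry of
   the right key at (l, k) is max(T(l,k), m(U^(l,k))), and the sets C express that
   this number is Y(l,k). *)
Require Import Defs.
From mathcomp Require Import all_boot zify.

Set Implicit Arguments.
Unset Strict Implicit.
Unset Printing Implicit Defensive.

(** * Families of weakly increasing subsequences *)

(* [fam X w g Y]: disjoint weakly increasing sequences with last entries X can
   be prolonged by g letters of the word w so that their last entries are Y. *)
Fixpoint fam (X w : seq nat) (g : nat) (Y : seq nat) : Prop :=
  if w is y :: w' then
    fam X w' g Y \/
    exists x X1 g', [/\ perm_eq X (x :: X1), x <= y, g = g'.+1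
                      & fam (y :: X1) w' g' Y]
  else g = 0 /\ perm_eq X Y.

(** Forgetting the last entries leaves a number that can be compared between words. Starting from
    [nseq d 0] stands for [d] empty sequences, since 0 is below every letter. *)
Definition gain (X w : seq nat) (g : nat) : Prop := exists Y, fam X w g Y.

Lemma gain_cons X y w g :
  gain X (y :: w) g <->
  gain X w g \/
  exists x X1 g', [/\ perm_eq X (x :: X1), x <= y, g = g'.+1
                    & gain (y :: X1) w g'].
Proof.
split=> [[Y /= [H|[x [X1 [g' [h1 h2 h3 h4]]]]]]|[[Y H]|[x [X1 [g' [h1 h2 h3 [Y h4]]]]]]].
- by left; exists Y.
- by right; exists x, X1, g'; split=> //; exists Y.
- by exists Y; left.
- by exists Y; right; exists x, X1, g'.
Qed.

Lemma perm_swap (x y : nat) Z : perm_eq (x :: y :: Z) (y :: x :: Z).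
Proof. by apply/permPl/(perm_catCA [:: x] [:: y] Z). Qed.

(** This separates the case where the sequence that took the previous letter also takes the next one
    from the case of two different sequences. Only values are compared, which is enough because last
    entries matter only as a multiset. *)
Lemma perm_cons_inv (x : nat) X y Y : perm_eq (x :: X) (y :: Y) ->
  (x = y /\ perm_eq X Y) \/
  exists Z, perm_eq X (y :: Z) /\ perm_eq Y (x :: Z).
Proof.
move=> H; have [e|ne] := eqVneq x y.
  by left; split=> //; move: H; rewrite e perm_cons.
have yX : y \in X.
  by have := perm_mem H y; rewrite !inE eqxx eq_sym (negPf ne) /=.
right; exists (rem y X); split; first exact: perm_to_rem.
rewrite -(perm_cons y) -(permPl H) -(permPr (perm_swap x y _)) perm_cons.
exact: perm_to_rem.
Qed.

Lemma fam_perm X X' w g Y : perm_eq X X' -> fam X w g Y -> fam X' w g Y.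
Proof.
elim: w X X' g => [|y w IH] X X' g HX /=.
  by move=> [-> H]; split=> //; apply: perm_trans H; rewrite perm_sym.
case=> [H|[x [X1 [g' [h1 h2 h3 h4]]]]]; [left; exact: IH H|right].
by exists x, X1, g'; split=> //; apply: perm_trans h1; rewrite perm_sym.
Qed.

Lemma fam_cat X w1 w2 g Y :
  fam X (w1 ++ w2) g Y <->
  exists g1 g2 Z, [/\ g = g1 + g2, fam X w1 g1 Z & fam Z w2 g2 Y].
Proof.
elim: w1 X g => [|y w IH] X g /=.
  split=> [H|[g1 [g2 [Z [-> [-> p] H]]]]]; first by exists 0, g, X; split.
  by apply: fam_perm H; rewrite perm_sym.
split=> [[/IH [g1 [g2 [Z [e h1 h2]]]]|[x [X1 [g' [p l ->]]]]]|].
- by exists g1, g2, Z; split=> //; left.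
- move=> /IH [g1 [g2 [Z [-> h1 h2]]]]; exists g1.+1, g2, Z; split=> //.
  by right; exists x, X1, g1.
move=> [g1 [g2 [Z [e [h1|[x [X1 [g' [p l eg h1]]]]] h2]]]].
  by left; apply/IH; exists g1, g2, Z.
right; exists x, X1, (g' + g2); split=> //; first by rewrite e eg.
by apply/IH; exists g', g2, Z.
Qed.

Lemma fam_size X w g Y : fam X w g Y -> size Y = size X.
Proof.
elim: w X g => [|y w IH] X g /=; first by move=> [_ /perm_size ->].
by case=> [/IH //|[x [X1 [g' [/perm_size -> _ _ /IH]]]]].
Qed.

Lemma gain_perm X X' w g : perm_eq X X' -> gain X w g -> gain X' w g.
Proof. by move=> p [Y H]; exists Y; apply: fam_perm H. Qed.

Lemma gain_skip X y w g : gain X w g -> gain X (y :: w) g.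
Proof. by move=> H; apply/gain_cons; left. Qed.

Lemma gain_take x X1 X y w g : perm_eq X (x :: X1) -> x <= y ->
  gain (y :: X1) w g -> gain X (y :: w) g.+1.
Proof. by move=> p l H; apply/gain_cons; right; exists x, X1, g. Qed.

(** A smaller last entry can be continued by every letter that continues a larger one; once such a
    letter is taken, the two families coincide. *)
Lemma gain_mono x x' X w g : x' <= x -> gain (x :: X) w g -> gain (x' :: X) w g.
Proof.
elim: w X x x' g => [|y w IH] X x x' g le; first by move=> [Y [-> _]]; exists (x' :: X).
move/gain_cons=> [H|[p [P [g' [pe py -> H]]]]]; first exact/gain_skip/(IH _ x).
case: (perm_cons_inv pe) => [[e p1]|[Z [p1 p2]]].
  apply: (@gain_take x' X) => //; first by apply: leq_trans py; rewrite -e.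
  by apply: gain_perm H; rewrite perm_cons perm_sym.
apply: (@gain_take p (x' :: Z)) => //.
  by rewrite (permPr (perm_swap _ _ _)) perm_cons.
apply: gain_perm (perm_swap x' y Z) _; apply: (IH _ x) => //.
by apply: gain_perm H; rewrite (permPr (perm_swap _ _ _)) perm_cons.
Qed.

(** * Plactic equivalence *)

Inductive plactic : seq nat -> seq nat -> Prop :=
| plactic_refl w : plactic w w
| plactic_sym w w' : plactic w w' -> plactic w' w
| plactic_trans w1 w2 w3 : plactic w1 w2 -> plactic w2 w3 -> plactic w1 w3
| plactic_xzy u v x y z : x <= y -> y < z ->
    plactic (u ++ [:: x; z; y] ++ v) (u ++ [:: z; x; y] ++ v)
| plactic_yxz u v x y z : x < y -> y <= z ->
    plactic (u ++ [:: y; x; z] ++ v) (u ++ [:: y; z; x] ++ v).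

#[local] Hint Resolve plactic_refl : core.

Lemma plactic_ctx u v w w' : plactic w w' -> plactic (u ++ w ++ v) (u ++ w' ++ v).
Proof.
elim=> {w w'} [w|w w' _|w1 w2 w3 _ h1 _ h2|u' v' x y z h1 h2|u' v' x y z h1 h2].
- by [].
- exact: plactic_sym.
- exact: plactic_trans h1 h2.
- by rewrite -!catA !(catA u u'); apply: plactic_xzy.
- by rewrite -!catA !(catA u u'); apply: plactic_yxz.
Qed.

Lemma plactic_catl u w w' : plactic w w' -> plactic (u ++ w) (u ++ w').
Proof. by move/(plactic_ctx u [::]); rewrite !cats0. Qed.

Lemma plactic_catr v w w' : plactic w w' -> plactic (w ++ v) (w' ++ v).
Proof. exact: (plactic_ctx [::] v). Qed.

(** If the largest letter [z] of a Knuth triple is discarded, both sides become equal; otherwise all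
    three letters stay and the relation persists. *)
Lemma plactic_filter t w w' : plactic w w' ->
  plactic [seq a <- w | a <= t] [seq a <- w' | a <= t].
Proof.
elim=> {w w'} [w|w w' _|w1 w2 w3 _ h1 _ h2|u v x y z h1 h2|u v x y z h1 h2].
- by [].
- exact: plactic_sym.
- exact: plactic_trans h1 h2.
- rewrite !filter_cat; apply: plactic_catl; apply: plactic_catr => /=.
  case: (leqP z t) => zt; last by case: (x <= t); case: (y <= t).
  have -> : y <= t by lia. have -> : x <= t by lia.
  exact: (plactic_xzy [::] [::]).
- rewrite !filter_cat; apply: plactic_catl; apply: plactic_catr => /=.
  case: (leqP z t) => zt; last by case: (x <= t); case: (y <= t).
  have -> : y <= t by lia. have -> : x <= t by lia.
  exact: (plactic_yxz [::] [::]).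
Qed.

(* The letters z and x of a descent are taken by distinct sequences. *)
Lemma gain_descent X v x z g : x < z ->
  gain X (z :: x :: v) g -> gain X (x :: z :: v) g.
Proof.
move=> xz /gain_cons [/gain_cons [H|[q [Q [g' [pQ qz -> H]]]]]|].
- exact/gain_skip/gain_skip.
- exact/(gain_take pQ qz)/gain_skip.
move=> [p [P [g1 [pP px -> /gain_cons [H|[q [Q [g2 [pQ qz -> H]]]]]]]]].
  exact/gain_skip/(gain_take pP px).
case: (perm_cons_inv pQ) => [[e _]|[Z [p1 p2]]]; first by lia.
apply: (@gain_take q (p :: Z)) => //.
  by rewrite (permPl pP) (permPr (perm_swap _ _ _)) perm_cons.
apply: (@gain_take p (x :: Z)) => //; first exact: perm_swap.
by apply: gain_perm H; rewrite (permPr (perm_swap _ _ _)) perm_cons.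
Qed.

(** The delicate case is one sequence taking [x] and then [z]. If [y] is free, that sequence takes
    [x], [y] instead and ends lower, so [gain_mono] applies. If another sequence takes [y], its
    previous entry is at most [y < z], so it can take [z] while the first one takes [x], [y]. *)
Lemma gain_xzy X v x y z g : x <= y -> y < z ->
  gain X (x :: z :: y :: v) g -> gain X (z :: x :: y :: v) g.
Proof.
move=> xy yz /gain_cons [/gain_cons [H|[q [Q [g' [pQ qz -> H]]]]]|].
- exact/gain_skip/gain_skip.
- exact/(gain_take pQ qz)/gain_skip.
move=> [p [P [g1 [pP px -> /gain_cons [H|[q [Q [g2 [pQ qz -> H]]]]]]]]].
  exact/gain_skip/(gain_take pP px).
case: (perm_cons_inv pQ) => [[xq pPQ]|[Z [p1 p2]]]; last first.
  apply: (@gain_take q (p :: Z)) => //.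
    by rewrite (permPl pP) (permPr (perm_swap _ _ _)) perm_cons.
  apply: (@gain_take p (z :: Z)) => //; first exact: perm_swap.
  by apply: gain_perm H; rewrite (permPr (perm_swap _ _ _)) perm_cons.
case/gain_cons: H => [H|[r [R [g3 [pR ry -> H]]]]].
  apply/gain_skip/(gain_take pP px)/(@gain_take x P) => //.
  apply: gain_mono (ltnW yz) _.
  by apply: gain_perm H; rewrite perm_cons perm_sym.
case: (perm_cons_inv pR) => [[e _]|[Z [p1 p2]]]; first by lia.
apply: (@gain_take r (p :: Z)); [|by lia|].
  by rewrite (permPl pP) (permPr (perm_swap _ _ _)) perm_cons (permPl pPQ).
apply: (@gain_take p (z :: Z)) => //; first exact: perm_swap.
apply: (@gain_take x (z :: Z)) => //.
by apply: gain_perm H; rewrite perm_cons.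
Qed.

(** Again the delicate case is one sequence taking [x] and then [z]. If [y] is free, it takes [y],
    [z] instead. If another sequence ends in [y], that one is prolonged by [z] and the first one
    stops at [x], which is lower than [y]. *)
Lemma gain_yxz X v x y z g : x < y -> y <= z ->
  gain X (y :: x :: z :: v) g -> gain X (y :: z :: x :: v) g.
Proof.
move=> xy yz /gain_cons [/gain_cons [/gain_cons [H|[q [Q [g1 [pQ qz -> H]]]]]|]|].
- exact/gain_skip/gain_skip/gain_skip.
- exact/gain_skip/(gain_take pQ qz)/gain_skip.
- move=> [p [P [g1 [pP px -> /gain_cons [H|[q [Q [g2 [pQ qz -> H]]]]]]]]].
    exact/gain_skip/gain_skip/(gain_take pP px).
  case: (perm_cons_inv pQ) => [[e pPQ]|[Z [p1 p2]]].
    apply: (gain_take pP); first by lia.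
    apply/(@gain_take y P)/gain_skip => //.
    by apply: gain_perm H; rewrite perm_cons perm_sym.
  apply/gain_skip/(@gain_take q (p :: Z)) => //.
    by rewrite (permPl pP) (permPr (perm_swap _ _ _)) perm_cons.
  apply: (@gain_take p (z :: Z)) => //; first exact: perm_swap.
  by apply: gain_perm H; rewrite (permPr (perm_swap _ _ _)) perm_cons.
move=> [r [R [g0 [pR ry -> H]]]]; apply: (gain_take pR ry).
case/gain_cons: H => [/gain_cons [H|[q [Q [g1 [pQ qz -> H]]]]]|].
- exact/gain_skip/gain_skip.
- exact/(gain_take pQ qz)/gain_skip.
move=> [p [P [g1 [pP px -> H]]]].
case/gain_cons: H => [H|[q [Q [g2 [pQ qz -> H]]]]].
  exact/gain_skip/(gain_take pP px).
case: (perm_cons_inv pP) => [[e _]|[Z [p1 p2]]]; first by lia.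
case: (perm_cons_inv pQ) => [[e pPQ]|[V [p3 p4]]].
  apply: (@gain_take y (p :: Z)) => //; first by rewrite perm_cons.
  apply: (@gain_take p (z :: Z)) => //; first exact: perm_swap.
  apply: gain_mono (ltnW xy) _; apply: gain_perm H.
  by rewrite (permPr (perm_swap _ _ _)) perm_cons -(permPl pPQ).
apply: (@gain_take q (p :: V)) => //.
  by rewrite (permPl pP) (permPr (perm_swap _ _ _)) perm_cons.
apply: (@gain_take p (z :: V)) => //; first exact: perm_swap.
by apply: gain_perm H; rewrite (permPr (perm_swap _ _ _)) perm_cons.
Qed.

Lemma gain_ctx u w w' :
  (forall X g, gain X w g -> gain X w' g) ->
  forall X g, gain X (u ++ w) g -> gain X (u ++ w') g.
Proof.
move=> Hw; elim: u => [//|y u IH] X g /gain_cons [H|[q [Q [g' [pQ qz -> H]]]]].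
  by apply/gain_cons; left; apply: IH.
by apply/gain_cons; right; exists q, Q, g'; split=> //; apply: IH.
Qed.

(** In the direction that creates a descent [z x] the third letter of the triple matters; in the
    opposite direction the descent is only resolved, and [gain_descent] suffices for both
    relations. *)
Lemma plactic_gain w w' : plactic w w' -> forall X g, gain X w g <-> gain X w' g.
Proof.
elim=> {w w'} [w|w w' _ IH|w1 w2 w3 _ h1 _ h2|u v x y z h1 h2|u v x y z h1 h2] X g.
- by [].
- by split=> /IH.
- by split=> [/h1 /h2|/h2 /h1].
- by split; apply: gain_ctx => Y h; [apply: gain_xzy | apply: gain_descent; lia].
- split; apply: gain_ctx => Y h; first exact: gain_yxz.
  by apply: (@gain_ctx [:: y]) => Z k; apply: gain_descent; lia.
Qed.

(** * Moving letters between two adjacent columns *)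

Lemma gtn_trans : transitive gtn.
Proof. by move=> a b c /=; lia. Qed.

(** Lists are matched from their heads, and [a] may be longer. With [leq] and columns listed
    downwards this is the row condition for top-justified columns, left one first; with [geq] and
    columns listed upwards it is the row condition for bottom-justified columns, right one first. *)
Fixpoint aligned (r : rel nat) (a b : seq nat) {struct b} : bool :=
  if b is y :: b' then
    if a is x :: a' then r x y && aligned r a' b' else false
  else true.

Lemma aligned_shift b B A :
  path gtn b B -> aligned geq B A -> aligned geq (b :: B) A.
Proof.
elim: A b B => [|a A IH] b [|b' B] //= /andP [h1 h2] /andP [h3 h4].
by rewrite IH // andbT; lia.
Qed.

Lemma aligned_shift_ltn a a0 b :
  path ltn a0 a -> aligned leq a b -> aligned leq (a0 :: a) b.
Proof.
elim: b a0 a => [|y b IH] a0 [|a1 a] //= /andP [h1 h2] /andP [h3 h4].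
by rewrite IH // andbT; lia.
Qed.

(* The columns a and b of a two-column tableau are listed downwards; x is put on
   top of the left one. *)
Lemma plactic_add_left a b x : path ltn x a -> aligned leq a b ->
  plactic (rev a ++ rev b ++ [:: x]) (rev a ++ x :: rev b).
Proof.
elim: b a x => [|y b IH] [|a0 a] x //=.
move=> /andP [xa pa] /andP [ay ab].
(* Moving [a0] past [rev b] makes [a0 y x] contiguous; as [x < a0 <= y], a Knuth relation turns it
   into [a0 x y]. Then [a0] moves back and [x] passes [rev b] by [e2]. *)
have e1 : plactic (rev (a0 :: a) ++ rev b) (rev a ++ rev b ++ [:: a0]).
  by rewrite rev_cons -cats1 -catA; apply: plactic_sym; apply: IH.
have e2 : plactic (rev (a0 :: a) ++ rev b ++ [:: x]) (rev (a0 :: a) ++ x :: rev b).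
  by apply: IH; rewrite /= ?xa //; apply: aligned_shift_ltn.
rewrite (rev_cons y) -cats1 -catA /= catA.
apply: plactic_trans (plactic_catr _ e1) _.
apply: plactic_trans (_ : plactic _ ((rev a ++ rev b) ++ [:: a0; x; y] ++ [::])) _.
  rewrite -!catA; do 2!apply: plactic_catl.
  by apply: plactic_sym; apply: (plactic_yxz [::] [::]).
have -> : (rev a ++ rev b) ++ [:: a0; x; y] ++ [::] = (rev a ++ rev b ++ [:: a0]) ++ [:: x; y].
  by rewrite -!catA.
apply: plactic_trans (plactic_catr _ (plactic_sym e1)) _.
rewrite -[x :: rev b ++ [:: y]]/((x :: rev b) ++ [:: y]) catA.
apply: plactic_trans (plactic_catr [:: y] e2).
by rewrite -!catA.
Qed.

Lemma plactic_add_left_col a b w : sorted ltn (rev w ++ a) -> aligned leq a b ->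
  plactic (rev a ++ rev b ++ w) (rev a ++ w ++ rev b).
Proof.
elim: w a => [|x w IH] a; first by rewrite cats0.
rewrite rev_cons cat_rcons => srt ab.
have px : sorted ltn (x :: a).
  by move: srt; rewrite !(sorted_pairwise ltn_trans) pairwise_cat => /and3P [].
have -> : rev a ++ rev b ++ x :: w = (rev a ++ rev b ++ [:: x]) ++ w.
  by rewrite -!catA.
apply: plactic_trans (plactic_catr _ (plactic_add_left px ab)) _.
have := IH (x :: a) srt (aligned_shift_ltn px ab).
by rewrite rev_cons -!cats1 -!catA.
Qed.

(** The mirror image of [plactic_add_left]: the columns are read upwards and bottom-justified, and
    the letter [x] at the bottom of the right one passes to the bottom of the left one. *)
Lemma plactic_add_right A B x : path gtn x B -> aligned geq B A ->
  plactic (A ++ x :: B) (x :: A ++ B).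
Proof.
elim: A B x => [|a A IH] [|b B] x //= /andP [bx pB] /andP [ab BA].
have e1 := IH B b pB BA.
have e2 : plactic (A ++ x :: b :: B) (x :: A ++ b :: B).
  by apply: IH; rewrite /= ?bx //; apply: aligned_shift.
apply: plactic_trans (plactic_catl [:: a] e2) _ => /=.
apply: plactic_trans (plactic_catl [:: a; x] e1) _ => /=.
apply: plactic_trans (_ : plactic _ [:: x, a, b & A ++ B]) _.
  exact: (plactic_xzy [::]).
exact: (plactic_catl [:: x; a] (plactic_sym e1)).
Qed.

(** * Exchanging two columns *)

(* Columns are read upwards.  Each letter of X is swapped with the first remaining
   letter of Z if that one is at least as large; when all of Z is swapped, the
   resulting word D E is plactic equivalent to X Z. *)
Fixpoint exchange (X Z : seq nat) : seq nat * seq nat :=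
  match X, Z with
  | x :: X', z :: Z' =>
      if x <= z then
        let: (D, E) := exchange X' Z' in (x :: D, z :: E)
      else let: (D, E) := exchange X' Z in (D, x :: E)
  | [::], _ => ([::], [::])
  | _, [::] => ([::], X)
  end.

Lemma exchange_subseq X Z : subseq (exchange X Z).1 X.
Proof.
elim: X Z => [|x X IH] [|z Z] //=.
case: ifP => _.
  by case: (exchange X Z) (IH Z) => D E /= h; rewrite eqxx.
case: (exchange X (z :: Z)) (IH (z :: Z)) => D E /= h.
exact: subseq_trans h (subseq_cons _ _).
Qed.

Lemma exchange_size2 X Z : size (exchange X Z).2 = size X.
Proof.
elim: X Z => [|x X IH] [|z Z] //=.
case: ifP => _.
  by case: (exchange X Z) (IH Z) => D E /= ->.
by case: (exchange X (z :: Z)) (IH (z :: Z)) => D E /= ->.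
Qed.

Lemma exchange_path x X Z : path gtn x X -> path gtn x Z -> path gtn x (exchange X Z).2.
Proof.
elim: X Z x => [|y X IH] [|z Z] x //= /andP [yx pX] /andP [zx pZ].
case: ifP => yz.
  case: (exchange X Z) (IH Z z) => D E /= h; rewrite zx h //.
  case: X pX {IH h} => //= a X /andP [h ->]; rewrite andbT; lia.
case: (exchange X (z :: Z)) (IH (z :: Z) y) => D E /= h; rewrite yx h //=.
by rewrite pZ andbT; lia.
Qed.

Lemma exchange_sorted X Z : sorted gtn X -> sorted gtn Z -> sorted gtn (exchange X Z).2.
Proof.
move=> sX sZ; pose b := (head 0 X + head 0 Z).+1.
apply: (@path_sorted _ _ b); apply: exchange_path; rewrite /b.
  by case: X sX {b} => //= x X ->; rewrite andbT; lia.
by case: Z sZ {b} => //= x Z ->; rewrite andbT; lia.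
Qed.

Lemma exchange_aligned X Z : sorted gtn X -> sorted gtn Z ->
  aligned geq (exchange X Z).2 (exchange X Z).1.
Proof.
elim: X Z => [|x X IH] [|z Z] //= sX sZ.
case: ifP => xz.
  case: (exchange X Z) (IH Z (path_sorted sX) (path_sorted sZ)) => D E /= ->.
  by rewrite andbT.
have := @exchange_path x X (z :: Z) sX.
case: (exchange X (z :: Z)) (IH (z :: Z) (path_sorted sX) sZ) => D E /= h p.
apply: aligned_shift => //; apply: p.
by rewrite /= sZ andbT; lia.
Qed.

(** Greedy matching succeeds whenever some matching [W] does: if [x <= z], the tail of [W] still
    matches the tail of [Z]; if [z < x], the first letter of [W] is not [x], so [W] is found in the
    rest of [X]. *)
Lemma exchange_matched X Z W : subseq W X -> size W = size Z -> all2 leq W Z ->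
  size (exchange X Z).1 = size Z /\ subseq Z (exchange X Z).2.
Proof.
elim: X Z W => [|x X IH] [|z Z] [|w W] //=.
move=> sub [sz] /andP [wz WZ].
case: ifP => xz.
  have : subseq W X.
    by case: ifP sub => // _ h; apply: subseq_trans (subseq_cons _ _) h.
  move/(IH Z)/(_ sz WZ); case: (exchange X Z) => D E /= [-> h].
  by rewrite eqxx.
have : subseq (w :: W) X by case: eqP sub => // e; lia.
move/(IH (z :: Z)) => /=; rewrite sz wz WZ => /(_ erefl erefl).
case: (exchange X (z :: Z)) => D E /= [-> h]; split=> //.
case: eqP => // e; exact: subseq_trans (subseq_cons Z z) h.
Qed.

Lemma plactic_insert_max x y X : path gtn x X -> x <= y ->
  plactic (x :: X ++ [:: y]) [:: x, y & X].
Proof.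
move=> pX xy.
have := @plactic_add_left_col [:: x] [:: y] X.
rewrite /= xy /= => /(_ _ erefl) h; apply: plactic_sym; apply: h.
move: pX; rewrite -[path _ _ _]/(sorted gtn (x :: X)) -rev_sorted rev_cons -cats1.
by [].
Qed.

(** If [x] is matched with [z], then [z] moves left past [X], the tails are exchanged, and [z] moves
    right past [D]. If [x] is not matched, it moves past [D] into the right column by
    [plactic_add_right]. *)
Lemma plactic_exchange X Z : sorted gtn X -> sorted gtn Z ->
  size (exchange X Z).1 = size Z ->
  plactic (X ++ Z) ((exchange X Z).1 ++ (exchange X Z).2).
Proof.
elim: X Z => [|x X IH] [|z Z] //= sX sZ; first by rewrite cats0.
case: ifP => xz.
  have sub := exchange_subseq X Z.
  move: (IH Z (path_sorted sX) (path_sorted sZ)) sub.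
  case: (exchange X Z) => D E /= h sub [sz].
  apply: plactic_trans (_ : plactic _ [:: x, z & X ++ Z]) _.
    have := plactic_catr Z (plactic_insert_max sX xz).
    by rewrite /= -catA.
  apply: plactic_trans (plactic_catl [:: x; z] (h sz)) _.
  have pD : path gtn x D.
    exact: (subseq_path gtn_trans sub sX).
  have := plactic_catr E (plactic_sym (plactic_insert_max pD xz)).
  by rewrite /= -catA.
have al := @exchange_aligned X (z :: Z) (path_sorted sX) sZ.
have pE := @exchange_path x X (z :: Z) sX.
move: (IH (z :: Z) (path_sorted sX) sZ) al pE.
case: (exchange X (z :: Z)) => D E /= h al pE sz.
apply: plactic_trans (plactic_catl [:: x] (h sz)) _ => /=.
apply: plactic_sym; apply: plactic_add_right => //; apply: pE.
by rewrite /= sZ andbT; lia.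
Qed.

(** * Columns and families *)

Lemma fam_column X w g Y : sorted gtn w -> fam X w g Y ->
  exists P P' Q, [/\ perm_eq X (P ++ Q), perm_eq Y (P' ++ Q), subseq P' w,
                     size P' = g & all2 leq P P'].
Proof.
elim: w X g => [|y w IH] X g /= sw.
  by move=> [-> p]; exists [::], [::], X; split=> //; rewrite perm_sym.
case=> [/IH [|P [P' [Q [h1 h2 h3 h4 h5]]]]|]; first exact: path_sorted sw.
  exists P, P', Q; split=> //; exact: subseq_trans h3 (subseq_cons _ _).
move=> [x [X1 [g' [pX xy -> /IH [|P [P' [Q [h1 h2 h3 h4 h5]]]]]]]].
  exact: path_sorted sw.
(* The letters of [P'] come from [w] and are less than [y], hence so are those of [P]. The sequence
   just prolonged by [y] therefore takes nothing more, and [y] stays in [Q]. *)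
have yP : y \notin P.
  have ltw a : a \in P' -> a < y.
    move/(mem_subseq h3) => aw.
    exact: (allP (order_path_min gtn_trans sw)).
  apply/negP=> yP; move: ltw h5 yP; clear.
  elim: P P' => [|p P IH] [|p' P'] //= ltw /andP [pp' h].
  rewrite inE => /orP [/eqP e|yP]; first by have := ltw p' (mem_head _ _); lia.
  by apply: (IH P') => // a ha; apply: ltw; rewrite inE ha orbT.
have yQ : y \in Q.
  by have := perm_mem h1 y; rewrite mem_cat (negPf yP) mem_head.
exists (x :: P), (y :: P'), (rem y Q); split=> //=.
- rewrite (permPl pX) perm_cons -(perm_cons y) (permPl h1).
  by rewrite -cat1s (permPr (permEl (perm_catCA _ _ _))) perm_cat2l /= perm_to_rem.
- rewrite (permPl h2) -cat1s (permPr (permEl (perm_catCA _ _ _))) perm_cat2l /=.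
  exact: perm_to_rem.
- by rewrite eqxx.
- by rewrite h4.
- by rewrite xy.
Qed.

Lemma fam_column_bound X w g Y : sorted gtn w -> fam X w g Y ->
  g <= minn (size w) (size X).
Proof.
move=> sw /(fam_column sw) [P [P' [Q [h1 _ h3 h4 h5]]]].
rewrite leq_min -{1}h4 size_subseq //= (perm_size h1) size_cat -h4.
move: h5; rewrite all2E => /andP [/eqP -> _]; exact: leq_addr.
Qed.

Lemma all2_leq_sumn s t : all2 leq s t -> sumn s <= sumn t.
Proof. by elim: s t => [|a s IH] [|b t] //= /andP [ab /IH]; lia. Qed.

Lemma all2_leq_sumn_eq s t : all2 leq s t -> sumn t <= sumn s -> s = t.
Proof.
elim: s t => [|a s IH] [|b t] //= /andP [ab h] le.
have le' := all2_leq_sumn h.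
have -> : a = b by lia.
by rewrite (IH t) //; lia.
Qed.

Lemma fam_column_full X w Y : sorted gtn w -> size X = size w ->
  fam X w (size w) Y ->
  [/\ perm_eq Y w, sumn X <= sumn w & sumn w <= sumn X -> perm_eq X w].
Proof.
move=> sw sX /(fam_column sw) [P [P' [Q [h1 h2 h3 h4 h5]]]].
have eP' : P' = w by apply/eqP; rewrite -(size_subseq_leqif h3) h4.
have eP : size P = size P' by move: h5; rewrite all2E => /andP [/eqP].
have Q0 : Q = [::].
  apply: size0nil; move/perm_size: h1; rewrite size_cat eP sX h4 => /eqP.
  by rewrite -[X in X == _]addn0 eqn_add2l => /eqP.
move: h1 h2; rewrite Q0 !cats0 eP' => h1 h2; rewrite eP' in h5.
split=> //; first by rewrite (perm_sumn h1); exact: all2_leq_sumn.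
by rewrite (perm_sumn h1) => h; rewrite (permPl h1) (all2_leq_sumn_eq h5 h).
Qed.

Lemma fam_replace P w Q : all2 leq P w -> fam (P ++ Q) w (size w) (w ++ Q).
Proof.
elim: w P Q => [|y w IH] [|p P] Q //= /andP [py Pw].
right; exists p, (P ++ Q), (size w); split=> //.
apply: (@fam_perm (P ++ y :: Q)).
  by rewrite -cat1s (permPl (permEl (perm_catCA _ _ _))).
have h := IH P (y :: Q) Pw.
suff: forall Y Y', perm_eq Y Y' -> forall X v g, fam X v g Y -> fam X v g Y'.
  apply; last exact: h.
  by rewrite -cat1s (permPl (permEl (perm_catCA _ _ _))).
clear=> Y Y' p X v; elim: v X => [|a v IH] X g /=.
  by move=> [-> h]; split=> //; rewrite (permPl h).
case=> [/IH|[x [X1 [g' [h1 h2 h3 /IH h4]]]]]; first by left.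
by right; exists x, X1, g'.
Qed.

(** * Fillings of sets of boxes and their column words *)

Definition downset (N : nat -> nat -> bool) : Prop :=
  forall j i j' i', N j' i' -> 0 < j <= j' -> 0 < i <= i' -> N j i.

(** During a slide the hole is at [(j, i)] and the entries fill [del E j i]. Boxes on both sides of
    the hole must stay comparable, so [ordered] compares all pairs of boxes and not only
    neighbours. *)
Definition del (E : nat -> nat -> bool) (j i : nat) : nat -> nat -> bool :=
  fun j' i' => E j' i' && ~~ ((j' == j) && (i' == i)).

Definition diff (N M : nat -> nat -> bool) : nat -> nat -> bool :=
  fun j i => N j i && ~~ M j i.

(* The boolean [i < i'] is read as 0 or 1. *)
Definition ordered (n : nat) (E : nat -> nat -> bool) (f : filling) : Prop :=
  (forall j i, E j i -> 1 <= f j i <= n) /\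
  forall j i j' i', E j i -> E j' i' -> j <= j' -> i <= i' ->
    f j i + (i < i') <= f j' i'.

Definition col_word (E : nat -> nat -> bool) (f : filling) (H j : nat) : seq nat :=
  [seq f j i | i <- rev (iota 1 H) & E j i].

Definition word (E : nat -> nat -> bool) (f : filling) (W H : nat) : seq nat :=
  flatten [seq col_word E f H j | j <- iota 1 W].

Lemma eq_col_word (E E' : nat -> nat -> bool) (f f' : filling) H j : (forall i, 0 < i -> E j i = E' j i) ->
  (forall i, E j i -> f j i = f' j i) -> col_word E f H j = col_word E' f' H j.
Proof.
move=> hE hf; rewrite /col_word.
have -> : [seq i <- rev (iota 1 H) | E' j i] = [seq i <- rev (iota 1 H) | E j i].
  by apply: eq_in_filter => i; rewrite mem_rev mem_iota => /andP [i0 _]; rewrite hE.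
by apply/eq_in_map => i; rewrite mem_filter => /andP [/hf].
Qed.

Lemma eq_word (E E' : nat -> nat -> bool) (f f' : filling) W H : (forall j i, 0 < j -> 0 < i -> E j i = E' j i) ->
  (forall j i, E j i -> f j i = f' j i) -> word E f W H = word E' f' W H.
Proof.
move=> hE hf; congr flatten; apply/eq_in_map => j.
rewrite mem_iota => /andP [j0 _]; apply: eq_col_word => i; [exact: hE | exact: hf].
Qed.

Lemma col_word_sorted n E f H j : ordered n E f -> sorted gtn (col_word E f H j).
Proof.
move=> [_ hf]; rewrite /col_word sorted_map.
apply: (@sub_in_sorted _ (E j) gtn); last first.
- by apply: (sorted_filter gtn_trans); rewrite rev_sorted iota_ltn_sorted.
- exact: filter_all.
move=> a b /= ha hb ba.
by have := hf _ _ _ _ hb ha (leqnn j) (ltnW ba); rewrite ba; lia.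
Qed.

Lemma rows_split i H : 0 < i <= H ->
  rev (iota 1 H) = rev (iota i.+1 (H - i)) ++ i :: rev (iota 1 i.-1).
Proof.
move=> hi; have -> : H = i.-1 + (1 + (H - i)) by lia.
rewrite !iotaD !rev_cat -catA /=; congr (rev (iota _ _) ++ _ :: _); lia.
Qed.

Lemma cols_split j W : 0 < j < W ->
  iota 1 W = iota 1 j.-1 ++ [:: j, j.+1 & iota j.+2 (W - j.+1)].
Proof.
move=> hj; have -> : W = j.-1 + (1 + (1 + (W - j.+1))) by lia.
rewrite !iotaD /=; congr (_ ++ [:: _, _ & iota _ _]); lia.
Qed.

(** The rows satisfying [Eb] form an initial segment of [rs] on which [Ea] holds too, so both
    filtered lists start with the same rows and are matched row by row. *)
Lemma aligned_rows (R r : rel nat) (Ea Eb : pred nat) (fa fb : nat -> nat) rs :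
  transitive R -> sorted R rs ->
  (forall s s', s \in rs -> s' \in rs -> R s s' -> Eb s' -> Eb s) ->
  (forall s, s \in rs -> Eb s -> Ea s /\ r (fa s) (fb s)) ->
  aligned r [seq fa s | s <- rs & Ea s] [seq fb s | s <- rs & Eb s].
Proof.
move=> tr; elim: rs => [//|s rs IH] /= srt hR hf.
have {}IH : aligned r [seq fa s | s <- rs & Ea s] [seq fb s | s <- rs & Eb s].
  apply: IH; first exact: path_sorted srt.
  - move=> a b ha hb; apply: hR; by rewrite inE ?ha ?hb orbT.
  - by move=> a ha; apply: hf; rewrite inE ha orbT.
case: (boolP (Eb s)) => hb.
  by have [-> h] := hf s (mem_head _ _) hb; rewrite /= h IH.
suff -> : [seq s0 <- rs | Eb s0] = [::] by case: ifP.
apply/eqP; rewrite -(negbK (_ == _)) -has_filter; apply/hasP => -[a ha ea].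
have /allP /(_ a ha) /= sa := order_path_min tr srt.
by rewrite (hR s a) ?mem_head ?inE ?ha ?orbT in hb.
Qed.

(** The hole splits the left column into [LA] below and [UA] above; at the same height, [x] splits
    the right column into [LB] and [UB]. Move [UA] past [LB], let [x] pass [UA], then move [x UA]
    back past [LB]. *)
Lemma plactic_slide_columns LA UA LB UB x :
  sorted gtn (LA ++ x :: UA) -> aligned leq (rev LA) (rev LB) ->
  path gtn x UB -> aligned geq UB UA ->
  plactic (LA ++ UA ++ LB ++ x :: UB) (LA ++ x :: UA ++ LB ++ UB).
Proof.
move=> srt al px alU.
have e1 : plactic (LA ++ LB ++ UA) (LA ++ UA ++ LB).
  have := @plactic_add_left_col (rev LA) (rev LB) UA.
  rewrite !revK -rev_cat rev_sorted; apply=> //.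
  by apply: (subseq_sorted gtn_trans) srt; apply: cat_subseq => //; apply: subseq_cons.
have e2 : plactic (LA ++ LB ++ x :: UA) (LA ++ x :: UA ++ LB).
  have := @plactic_add_left_col (rev LA) (rev LB) (x :: UA).
  by rewrite !revK -rev_cat rev_sorted; apply.
have := plactic_catr (x :: UB) (plactic_sym e1); rewrite -!catA => h.
apply: plactic_trans h _.
apply: plactic_trans (plactic_catl LA (plactic_catl LB (plactic_add_right px alU))) _.
by have := plactic_catr UB e2; rewrite -!catA /= -!catA.
Qed.

(** * One elementary move of the hole in a slide *)

Section Slides.

Variables (n : nat) (N M : nat -> nat -> bool) (W H : nat).
Hypotheses (dN : downset N) (dM : downset M).
Hypothesis boundN : forall j i, N j i -> 0 < j <= W /\ 0 < i <= H.

Let E := diff N M.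

Let E_SE j i j' i' : E j i -> N j' i' -> j <= j' -> i <= i' -> E j' i'.
Proof.
move=> /andP [Nji Mji] N' jj ii; rewrite /E /diff N' /=.
have [hj hi] := boundN Nji.
apply: contra Mji => M'; apply: dM M' _ _; lia.
Qed.

Let E_N j i : E j i -> N j i. Proof. by case/andP. Qed.

Let E_mid j i j' i' a b : E j i -> E j' i' -> j <= a <= j' -> i <= b <= i' -> E a b.
Proof.
move=> e e' ha hb; have [hj hi] := boundN (E_N e).
apply: (E_SE e); [apply: dN (E_N e') _ _|..]; lia.
Qed.

Lemma below_ordered f j i : E j i -> N j i.+1 ->
  (N j.+1 i -> f j i.+1 <= f j.+1 i) -> ordered n (del E j i) f ->
  ordered n (del E j i.+1) (update f j i (f j i.+1)).
Proof.
move=> e nb hr [hb ho].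
have eb : E j i.+1 by apply: E_SE e nb _ _; lia.
have db : del E j i j i.+1 by rewrite /del eb /=; lia.
split=> [a b|a b c d]; rewrite /update.
  move=> /andP [ea ne]; case: ifP => h; first exact: hb.
  by apply: hb; rewrite /del ea h.
move=> /andP [ea ne] /andP [ec ne'] ac bd.
case: ifP => h; case: ifP => h'.
- lia.
- move: h => /andP [/eqP e1 /eqP e2]; subst a b.
  have dc : del E j i c d by rewrite /del ec h'.
  have [cj|cj] := eqVneq c j.
    by have := ho _ _ _ _ db dc ac; lia.
  (* A box in a column further right may lie in the row of the hole, above the old place of the
     moved entry; the comparison goes through the right neighbour of the hole. *)
  have nr : N j.+1 i.
    have [? ?] := boundN (E_N e); apply: (dN (E_N ec)); lia.
  have er : del E j i j.+1 i.
    rewrite /del (E_SE e nr) //; lia.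
  by have := ho _ _ _ _ er dc; have := hr nr; lia.
- move: h' => /andP [/eqP e1 /eqP e2]; subst c d.
  have da : del E j i a b by rewrite /del ea h.
  by have := ho _ _ _ _ da db ac; lia.
- by apply: ho; rewrite // /del ?ea ?ec ?h ?h'.
Qed.

Lemma right_ordered f j i : E j i -> N j.+1 i ->
  (N j i.+1 -> f j.+1 i < f j i.+1) -> ordered n (del E j i) f ->
  ordered n (del E j.+1 i) (update f j i (f j.+1 i)).
Proof.
move=> e nb hr [hb ho].
have eb : E j.+1 i by apply: E_SE e nb _ _; lia.
have db : del E j i j.+1 i by rewrite /del eb /=; lia.
split=> [a b|a b c d]; rewrite /update.
  move=> /andP [ea ne]; case: ifP => h; first exact: hb.
  by apply: hb; rewrite /del ea h.
move=> /andP [ea ne] /andP [ec ne'] ac bd.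
case: ifP => h; case: ifP => h'.
- lia.
- move: h => /andP [/eqP e1 /eqP e2]; subst a b.
  have dc : del E j i c d by rewrite /del ec h'.
  have [cj|cj] := eqVneq c j; last by have := ho _ _ _ _ db dc; lia.
  have nr : N j i.+1.
    have [? ?] := boundN (E_N e); apply: (dN (E_N ec)); lia.
  have er : del E j i j i.+1.
    rewrite /del (E_SE e nr) //; lia.
  by have := ho _ _ _ _ er dc; have := hr nr; lia.
- move: h' => /andP [/eqP e1 /eqP e2]; subst c d.
  have da : del E j i a b by rewrite /del ea h.
  by have := ho _ _ _ _ da db; lia.
- by apply: ho; rewrite // /del ?ea ?ec ?h ?h'.
Qed.

Let map_del (rs : seq nat) a j i (f : filling) : ((a == j) && (i \in rs)) = false ->
  [seq f a r | r <- rs & del E j i a r] = [seq f a r | r <- rs & E a r].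
Proof.
move=> h; congr map; apply: eq_in_filter => r hr; rewrite /del.
case: eqP h => [->|]; rewrite ?andbT //= => h.
by case: eqP => [er|]; rewrite ?andbT //; rewrite -er hr in h.
Qed.

Let map_update (rs : seq nat) a j i (f : filling) v (P : pred nat) :
  ((a == j) && (i \in rs)) = false ->
  [seq update f j i v a r | r <- rs & P r] = [seq f a r | r <- rs & P r].
Proof.
move=> h; apply/eq_in_map => r; rewrite mem_filter => /andP [_ hr]; rewrite /update.
case: eqP h => [->|] //= h.
by case: eqP => [er|] //; rewrite -er hr in h.
Qed.

Lemma below_word f j i : E j i -> N j i.+1 ->
  word (del E j i) f W H = word (del E j i.+1) (update f j i (f j i.+1)) W H.
Proof.
move=> e nb; have eb : E j i.+1 by apply: E_SE e nb _ _; lia.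
congr flatten; apply/eq_in_map => a ha.
have [? ?] := boundN nb; have [? ?] := boundN (E_N e).
rewrite /col_word; have [->|aj] := eqVneq a j; last first.
  by rewrite map_update ?(negPf aj) // !map_del // (negPf aj).
rewrite (@rows_split i H); last by lia.
have -> : rev (iota i.+1 (H - i)) = rev (iota i.+2 (H - i.+1)) ++ [:: i.+1].
  have -> : H - i = 1 + (H - i.+1) by lia.
  by rewrite iotaD rev_cat addn1.
rewrite -catA !filter_cat !map_cat.
have m1 : (i \in rev (iota i.+2 (H - i.+1))) = false by rewrite mem_rev mem_iota; clear; lia.
have m2 : (i \in rev (iota 1 i.-1)) = false by rewrite mem_rev mem_iota; clear; lia.
have m3 : (i.+1 \in rev (iota i.+2 (H - i.+1))) = false by rewrite mem_rev mem_iota; clear; lia.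
have m4 : (i.+1 \in rev (iota 1 i.-1)) = false by rewrite mem_rev mem_iota; clear; lia.
have d1 : del E j i j i = false by rewrite /del !eqxx andbF.
have d2 : del E j i j i.+1 by rewrite /del eb; clear; lia.
have d3 : del E j i.+1 j i by rewrite /del e; clear; lia.
have d4 : del E j i.+1 j i.+1 = false by rewrite /del !eqxx andbF.
rewrite /= d1 d2 d3 d4 /=.
have -> : update f j i (f j i.+1) j i = f j i.+1 by rewrite /update !eqxx.
by rewrite !map_update ?m1 ?m2 ?andbF // !map_del ?m1 ?m2 ?m3 ?m4 ?andbF.
Qed.

Lemma right_word f j i : E j i -> N j.+1 i ->
  (N j i.+1 -> f j.+1 i < f j i.+1) -> ordered n (del E j i) f ->
  plactic (word (del E j i) f W H)
          (word (del E j.+1 i) (update f j i (f j.+1 i)) W H).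
Proof.
move=> e nb hr ho; have eb : E j.+1 i by apply: E_SE e nb _ _; lia.
have ho' := right_ordered e nb hr ho.
have [? ?] := boundN nb; have [? ?] := boundN (E_N e).
have srt' := col_word_sorted H j ho'; have srt := col_word_sorted H j.+1 ho.
rewrite /word (@cols_split j W) ?map_cat ?flatten_cat; last by lia.
have other rs : j \notin rs -> j.+1 \notin rs ->
    [seq col_word (del E j i) f H a | a <- rs]
    = [seq col_word (del E j.+1 i) (update f j i (f j.+1 i)) H a | a <- rs].
  move=> j1 j2; apply/eq_in_map => a ha.
  have a1 : (a == j) = false by apply: contraNF j1 => /eqP <-.
  have a2 : (a == j.+1) = false by apply: contraNF j2 => /eqP <-.
  by rewrite /col_word map_update ?a1 // !map_del // (a1, a2).
rewrite (other (iota 1 j.-1)) ?mem_iota; try lia.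
rewrite /= (other (iota j.+2 _)) ?mem_iota; try lia.
apply: plactic_catl => /=.
rewrite !catA; apply: plactic_catr.
move: srt srt'; rewrite /col_word (@rows_split i H); last by lia.
rewrite !filter_cat !map_cat.
have d1 : del E j i j i = false by rewrite /del !eqxx andbF.
have d2 : del E j i j.+1 i by rewrite /del eb; clear; lia.
have d3 : del E j.+1 i j i by rewrite /del e; clear; lia.
have d4 : del E j.+1 i j.+1 i = false by rewrite /del !eqxx andbF.

rewrite /= d1 d2 d3 d4 /=.
have -> : update f j i (f j.+1 i) j i = f j.+1 i by rewrite /update !eqxx.
have m1 : (i \in rev (iota i.+1 (H - i))) = false by rewrite mem_rev mem_iota; clear; lia.
have m2 : (i \in rev (iota 1 i.-1)) = false by rewrite mem_rev mem_iota; clear; lia.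
have m3 : (j.+1 == j) = false by clear; lia.
rewrite !map_update ?m1 ?m2 ?m3 ?andbF //.
rewrite !map_del ?m1 ?m2 ?andbF //.
move=> srt srt'; rewrite -!catA /=; apply: plactic_slide_columns => //.
- rewrite -!map_rev -!filter_rev !revK.
  apply: (@aligned_rows ltn) => [|||s]; first exact: ltn_trans.
  + exact: iota_ltn_sorted.
  + move=> s s'; rewrite !mem_iota => hs hs' ss es'.
    by apply: (E_mid eb es'); move: hs hs' ss; clear; lia.
  + rewrite mem_iota => hs es.
    have es' : E j s by apply: (E_SE e); [apply: (dN (E_N es))|..]; move: hs (boundN (E_N e)); clear; lia.
    split=> //; have [_ ho2] := ho.
    have := ho2 j s j.+1 s; rewrite ltnn addn0 /del es es' /=; apply; move: hs; clear; lia.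
- exact: (subseq_sorted gtn_trans (suffix_subseq _ _) srt).
- apply: (@aligned_rows gtn) => [|||s]; first exact: gtn_trans.
  + by rewrite rev_sorted iota_ltn_sorted.
  + move=> s s'; rewrite !mem_rev !mem_iota => hs hs' ss es'.
    by apply: (E_mid es' e); move: hs hs' ss => /=; clear; lia.
  + rewrite mem_rev mem_iota => hs es.
    have es' : E j.+1 s by apply: (E_SE es); [apply: (dN (E_N eb))|..]; move: hs (boundN (E_N e)); clear; lia.
    split=> //; have [_ ho2] := ho.
    have := ho2 j s j.+1 s; rewrite ltnn addn0 /del es es' /=; apply; move: hs; clear; lia.
Qed.

End Slides.

(** * Partitions *)

Lemma row_len_anti mu i i' : is_partition mu -> i <= i' -> row_len mu i' <= row_len mu i.
Proof.
move=> pmu ii; rewrite /row_len.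
have [h|h] := ltnP i'.-1 (size mu); last by rewrite nth_default.
have tr : transitive geq by move=> a b c /=; lia.
apply: (sorted_leq_nth tr (fun a => leqnn a) 0 pmu); rewrite ?inE; lia.
Qed.

Lemma partition_intro mu : (forall i, 0 < i -> row_len mu i.+1 <= row_len mu i) ->
  is_partition mu.
Proof. by move=> h; apply/(sortedP 0) => i _; exact: (h i.+1). Qed.

Lemma downset_box mu : is_partition mu -> downset (box mu).
Proof.
move=> pmu j i j' i' /and3P [_ _ h] hj hi; rewrite /box.
have : i <= i' by lia.
by move/(row_len_anti pmu); lia.
Qed.

Lemma box_bound mu j i : is_partition mu -> box mu j i ->
  0 < j <= ncols mu /\ 0 < i <= size mu.
Proof.
move=> pmu /and3P [j0 i0 h]; have := row_len_anti pmu i0; rewrite -/(ncols mu) => hc.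
split; first by lia.
have [|h'] := leqP i (size mu); first by lia.
move: h; rewrite /row_len nth_default; lia.
Qed.

Lemma box_col mu j i : is_partition mu -> 0 < j ->
  box mu j i = (0 < i <= col_len mu j).
Proof.
move=> pmu j0; rewrite /box j0 /=; case: i => [//|i] /=.
rewrite /row_len /col_len /=.
elim: mu pmu i => [|m mu IH] /= p i; first by rewrite nth_nil; lia.
have tr : transitive geq by move=> a b c /=; lia.
have h : (j <= m) = false -> count (leq j) mu = 0.
  move=> jm; apply/eqP; rewrite -leqn0 leqNgt -has_count; apply/hasP => -[a ha ja].
  have /allP /(_ a ha) /= := order_path_min tr p; lia.
case: i => [|i] /=.
  by case: (j <= m) h => [_|/(_ erefl) ->]; lia.
rewrite IH; last exact: path_sorted p.
by case: (j <= m) h => [_|/(_ erefl) ->]; lia.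
Qed.

Lemma row_len_shorten mu i a : 0 < i -> 0 < a ->
  row_len (shorten_row mu i) a = if a == i then (row_len mu i).-1 else row_len mu a.
Proof.
move=> i0 a0; rewrite /row_len /shorten_row nth_set_nth /=.
have -> : (a.-1 == i.-1) = (a == i) by lia.
by [].
Qed.

Lemma shorten_partition mu i : is_partition mu -> 0 < i ->
  row_len mu i.+1 < row_len mu i -> is_partition (shorten_row mu i).
Proof.
move=> pmu i0 h; apply: partition_intro => a a0; rewrite !row_len_shorten //.
have := row_len_anti pmu (leqnSn a).
case: (eqVneq a.+1 i) => [e|_]; case: (eqVneq a i) => [e'|_]; subst; lia.
Qed.

Lemma box_shorten mu i a b : 0 < i -> 0 < row_len mu i ->
  box (shorten_row mu i) a b = del (box mu) (row_len mu i) i a b.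
Proof.
move=> i0 r0; rewrite /del /box.
case: (posnP b) => [->|b0]; first by rewrite !andbF.
rewrite row_len_shorten //; case: eqP => [->|]; rewrite ?andbT ?andbF ?andbT /=; lia.
Qed.

Lemma sumn_shorten mu i : 0 < i -> 0 < row_len mu i ->
  sumn (shorten_row mu i) < sumn mu.
Proof.
move=> i0 r0; have hs : i.-1 < size mu.
  by rewrite ltnNge; apply/negP => h; move: r0; rewrite /row_len nth_default.
rewrite /shorten_row sumn_set_nth_ltn // -/(row_len mu i).
have : row_len mu i <= sumn mu; last lia.
rewrite /row_len; elim: mu i.-1 hs {i0 r0} => [|m mu IH] [|k] //= h; first lia.
by have := IH k h; lia.
Qed.

(** * Jeu de taquin *)

(** A difference of two downsets is convex, so the path down column [j] and then along row [i']
    stays inside it and adds up the inequalities between neighbours. *)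
Lemma semistandard_ordered n N M f : downset N -> downset M ->
  (forall j i, N j i -> 0 < j /\ 0 < i) ->
  semistandard_on n (diff N M) f <-> ordered n (diff N M) f.
Proof.
move=> dN dM pN; split=> [[hb hr hc]|[hb ho]]; last first.
  split=> // j i h h'.
    by have := ho _ _ _ _ h h' (leqnSn j) (leqnn i); rewrite ltnn addn0.
  by have := ho _ _ _ _ h h' (leqnn j) (leqnSn i); rewrite ltnSn addn1.
split=> // j i j' i' h h' jj ii.
have mid a b : j <= a <= j' -> i <= b <= i' -> diff N M a b.
  case/andP: h => n1 m1; case/andP: h' => n2 m2 ha hb'.
  have [j0 i0] := pN _ _ n1; apply/andP; split; first by apply: dN n2 _ _; lia.
  by apply: contra m1 => m; apply: dM m _ _; lia.
have right k : j + k <= j' -> f j i' <= f (j + k) i'.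
  elim: k => [|k IH] hk; first by rewrite addn0.
  apply: leq_trans (IH _) _; first lia.
  rewrite addnS; apply: hr; apply: mid; lia.
have down k : i + k <= i' -> f j i + (0 < k) <= f j (i + k).
  elim: k => [|k IH] hk; first by rewrite !addn0.
  have : f j (i + k) < f j (i + k).+1 by apply: hc; apply: mid; lia.
  have := IH; rewrite addnS; lia.
have := down (i' - i); have := right (j' - j); rewrite !subnKC //; lia.
Qed.

Lemma skew_ordered n S : semistandard_skew n S ->
  ordered n (skew_box S) (entry S).
Proof.
move=> [pi po _ /semistandard_ordered]; apply; try exact: downset_box.
by move=> j i /(box_bound po) [/andP [? _] /andP [? _]].
Qed.

Lemma slide_spec n nu M W H f j i f' j' i' :
  slide nu f j i f' j' i' -> downset (box nu) -> downset M ->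
  (forall a b, box nu a b -> 0 < a <= W /\ 0 < b <= H) ->
  let E := diff (box nu) M in
  E j i -> ordered n (del E j i) f ->
  [/\ E j' i', ~~ box nu j'.+1 i', ~~ box nu j' i'.+1, ordered n (del E j' i') f'
    & plactic (word (del E j i) f W H) (word (del E j' i') f' W H)].
Proof.
move=> sl dN dM bd E.
have step a b a' b' : E a b -> box nu a' b' -> a <= a' -> b <= b' -> E a' b'.
  move=> /andP [n1 m1] n2 aa bb; apply/andP; split=> //.
  by apply: contra m1 => m; have [? ?] := bd _ _ n1; apply: dM m _ _; lia.
elim: sl => {f j i f' j' i'} [f j i n1 n2 e o|f j i f' j' i' nb hr _ IH e o|f j i f' j' i' nb hr _ IH e o].
- by split.
- have [||h1 h2 h3 h4 h5] := IH; first exact: step e nb _ _.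
    exact: (below_ordered dN dM bd e nb hr o).
  split=> //; apply: plactic_trans h5.
  by rewrite (below_word dM bd f e nb).
- have [||h1 h2 h3 h4 h5] := IH; first exact: step e nb _ _.
    exact: (right_ordered dN dM bd e nb hr o).
  split=> //; apply: plactic_trans h5.
  exact: (right_word dN dM bd e nb hr o).
Qed.

Lemma slide_exists nu f j i : is_partition nu ->
  exists f' j' i', slide nu f j i f' j' i'.
Proof.
move=> pnu; have [m] := ubnP ((ncols nu).+1 + (size nu).+1 - (j + i)).
elim: m f j i => [//|m IH] f j i hm.
case: (boolP (box nu j i.+1)) => nb; last first.
  case: (boolP (box nu j.+1 i)) => nr; last by exists f, j, i; exact: slide_stop.
  have [? ?] := box_bound pnu nr.
  have [|f' [j' [i' h]]] := IH (update f j i (f j.+1 i)) j.+1 i; first by lia.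
  by exists f', j', i'; apply: slide_right => // h'; rewrite h' in nb.
have [? ?] := box_bound pnu nb.
case: (boolP (box nu j.+1 i ==> (f j i.+1 <= f j.+1 i))).
  move/implyP=> hr.
  have [|f' [j' [i' h]]] := IH (update f j i (f j i.+1)) j i.+1; first by lia.
  by exists f', j', i'; apply: slide_below.
rewrite negb_imply => /andP [nr hr].
have [? ?] := box_bound pnu nr.
have [|f' [j' [i' h]]] := IH (update f j i (f j.+1 i)) j.+1 i; first by lia.
by exists f', j', i'; apply: slide_right => // _; rewrite ltnNge.
Qed.

Definition fits (W H : nat) (nu : seq nat) : Prop :=
  forall j i, box nu j i -> 0 < j <= W /\ 0 < i <= H.

Lemma jdt_spec n S S' W H : semistandard_skew n S -> jdt_step S S' ->
  fits W H (outer S) ->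
  [/\ semistandard_skew n S', fits W H (outer S')
    & plactic (word (skew_box S) (entry S) W H) (word (skew_box S') (entry S') W H)].
Proof.
move=> ss [i [f' [j' [i' [i0 hc sl eS']]]]] bd.
have [pi po hio _] := ss; have o := skew_ordered ss.
set r := row_len (inner S) i in hc sl eS'.
have r0 : 0 < r by lia.
(* The corner leaves the inner shape first, so that it counts as a box of the difference [E]: it is
   the initial hole. *)
pose M := box (shorten_row (inner S) i).
have dM : downset M by apply/downset_box/shorten_partition.
have dN := downset_box po.
pose E := diff (box (outer S)) M.
have hole : E r i.
  rewrite /E /diff /M box_shorten // /del !eqxx andbF andbT /box r0 i0; exact: hio.
have skE : skew_box S =2 del E r i.
  move=> a b; rewrite /skew_box /E /del /diff /M box_shorten // /del -/r.
  case: (boolP ((a == r) && (b == i))) => [/andP [/eqP -> /eqP ->]|_]; last first.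
    by rewrite !andbT.
  by rewrite andbF /box r0 i0 leqnn andbF.
have o' : ordered n (del E r i) (entry S).
  by case: o => h1 h2; split=> [a b|a b c d]; rewrite -!skE; auto.
have [e' n1 n2 o'' pl] := slide_spec sl dN dM bd hole o'.
have [j'0 i'0] : 0 < j' /\ 0 < i' by case/andP: e' => /and3P [].
have jr : j' = row_len (outer S) i'.
  by case/andP: e' n1 => /and3P [_ _ h] _; rewrite /box i'0 /=; lia.
have hco : row_len (outer S) i'.+1 < row_len (outer S) i'.
  by rewrite -jr ltnNge; apply: contra n2 => h; rewrite /box j'0.
have r0' : 0 < row_len (outer S) i' by rewrite -jr.
have skE' : skew_box S' =2 del E j' i'.
  move=> a b; rewrite eS' /skew_box /= box_shorten // -jr /E /del /diff -/M.
  by rewrite andbAC.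
have pi' : is_partition (inner S') by rewrite eS'; apply: shorten_partition.
have po' : is_partition (outer S') by rewrite eS'; apply: shorten_partition.
have fE : entry S' = f' by rewrite eS'.
split.
- have hrow a : 0 < a -> row_len (inner S') a <= row_len (outer S') a.
    move=> a0; rewrite eS' /= !row_len_shorten //.
    have := hio a; case: (eqVneq a i') => [ea|_]; last by case: ifP => [/eqP ->|]; lia.
    move: e' => /andP [_]; rewrite /M /box j'0 i'0 row_len_shorten // -jr -ea.
    by case: ifP => [/eqP ->|]; lia.
  (* Row index 0 reads the same part as row index 1, because [row_len] takes the predecessor. *)
  split=> // [[|a]|]; [exact: (hrow 1)|exact: hrow|].
  apply/(semistandard_ordered n _ (downset_box po') (downset_box pi')).
    by move=> a b /and3P [].
  by case: o'' => h1 h2; split=> [a b|a b c d]; rewrite -![diff _ _ _ _]/(skew_box S' _ _) ?skE' fE; auto.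
- move=> a b; rewrite eS' /= box_shorten // => /andP [h _]; exact: bd h.
- rewrite (@eq_word (skew_box S) (del E r i) _ (entry S)) //.
  by rewrite (@eq_word (skew_box S') (del E j' i') _ f') ?fE.
Qed.

Lemma rectifies_plactic n lam T S W H : rectifies_to lam T S ->
  semistandard_skew n S -> fits W H (outer S) ->
  plactic (word (skew_box S) (entry S) W H) (word (box lam) T W H).
Proof.
elim=> {S} [S [h1 h2 h3] _ _|S S' st _ IH ss bd].
  have e j i : skew_box S j i = box lam j i by rewrite /skew_box h1 h2 andbT.
  rewrite (@eq_word _ (box lam) _ T) // => j i; rewrite e; exact: h3.
have [ss' bd' pl] := jdt_spec ss st bd.
exact: plactic_trans pl (IH ss' bd').
Qed.

(** The last nonempty row of the inner shape ends in a corner, and each slide lowers the size of the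
    inner shape. The straight tableau reached is left open here; it is identified afterwards by its
    plactic class. *)
Lemma rectification_exists n S W H : semistandard_skew n S -> fits W H (outer S) ->
  exists S', [/\ semistandard_skew n S', fits W H (outer S'),
    (forall j i, ~~ box (inner S') j i),
    plactic (word (skew_box S) (entry S) W H) (word (skew_box S') (entry S') W H)
  & forall lam T, is_straight lam T S' -> rectifies_to lam T S].
Proof.
have [m] := ubnP (sumn (inner S)); elim: m S => // m IH S hm ss bd.
have [pi po _ _] := ss.
case: (posnP (row_len (inner S) 1)) => [r0|r1].
  exists S; split=> // [j i|lam T]; last exact: rectifies_done.
  apply/negP => b; have [] := box_bound pi b; rewrite /ncols r0; lia.
pose i := col_len (inner S) 1.
have rows a : 0 < a -> (0 < row_len (inner S) a) = (a <= i).
  by move=> a0; have := box_col a pi (ltn0Sn 0); rewrite /box a0.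
have i0 : 0 < i by rewrite -(rows 1).
have ri : 0 < row_len (inner S) i by rewrite rows.
have rs : row_len (inner S) i.+1 = 0.
  by apply/eqP; rewrite -leqn0 leqNgt rows // ltnn.
have [f' [j' [i' sl]]] := slide_exists (entry S) (row_len (inner S) i) i po.
pose S1 := Skew (shorten_row (inner S) i) (shorten_row (outer S) i') f'.
have st : jdt_step S S1 by exists i, f', j', i'; rewrite rs.
have [ss1 bd1 pl] := jdt_spec ss st bd.
have [|S' [h1 h2 h3 h4 h5]] := IH S1 _ ss1 bd1.
  by have := sumn_shorten i0 ri; rewrite /S1 /=; lia.
exists S'; split=> // [|lam T hT]; first exact: plactic_trans pl h4.
exact: rectifies_step st (h5 _ _ hT).
Qed.

(** * Maximal families in tableaux *)

Lemma fam_flatten_bound X cs g Y : all (sorted gtn) cs -> fam X (flatten cs) g Y ->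
  g <= sumn [seq minn (size c) (size X) | c <- cs].
Proof.
elim: cs X g => [|c cs IH] X g /=; first by move=> _ [-> _].
move=> /andP [sc scs] /fam_cat [g1 [g2 [Z [-> h1 h2]]]].
apply: leq_add; first exact: fam_column_bound h1.
by rewrite -(fam_size h1); exact: IH h2.
Qed.

Lemma gain_skips X u w g : gain X w g -> gain X (u ++ w) g.
Proof. by elim: u => // y u IH /IH; exact: gain_skip. Qed.

Lemma aligned_take r d a b : aligned r a b -> aligned r (take d a) (take d b).
Proof.
elim: d a b => [|d IH] [|x a] [|y b] //=.
by move=> /andP [-> /IH].
Qed.

Lemma aligned_all2 r a b : aligned r a b -> all2 r (take (size b) a) b.
Proof. by elim: b a => [|y b IH] [|x a] //= /andP [-> /IH]. Qed.

Lemma all2_rev (r : rel nat) a b : all2 r a b -> all2 r (rev a) (rev b).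
Proof.
rewrite !all2E !size_rev => /andP [/eqP e h]; rewrite e eqxx /=.
by rewrite -rev_zip // all_rev.
Qed.

(** Each of the first [d] rows is followed by one sequence, and the lower entries of every column
    are skipped. [Q] collects the ends of the rows that have already stopped. *)
Lemma gain_rows d c cs Q : path (fun a b => aligned leq (take d a) (take d b)) c cs ->
  gain (take d c ++ Q) (flatten [seq rev a | a <- cs])
       (sumn [seq minn (size a) d | a <- cs]).
Proof.
elim: cs c Q => [|c' cs IH] c Q /=.
  by move=> _; exists (take d c ++ Q).
move=> /andP [al p].
pose e := size (take d c').
have he : e = minn (size c') d by rewrite /e size_take_min minnC.
have [Y hY] := IH c' (drop e (take d c) ++ Q) p.
have h1 := all2_rev (aligned_all2 al); rewrite -/e in h1.
have h2 := fam_replace (drop e (take d c) ++ Q) h1.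
have h3 : gain (take d c ++ Q) (rev (take d c') ++ flatten [seq rev a | a <- cs])
      (minn (size c') d + sumn [seq minn (size a) d | a <- cs]).
  exists Y; apply/fam_cat; exists e, (sumn [seq minn (size a) d | a <- cs]).
  exists (rev (take d c') ++ drop e (take d c) ++ Q); split; first by rewrite he.
    apply: fam_perm (_ : fam (rev (take e (take d c)) ++ drop e (take d c) ++ Q) _ _ _).
      by rewrite -{3}(cat_take_drop e (take d c)) -catA perm_cat2r perm_rev.
    by move: h2; rewrite size_rev.
  by apply: fam_perm hY; rewrite perm_cat2r perm_sym perm_rev.
by rewrite -{1}(cat_take_drop d c') rev_cat -catA; exact: gain_skips.
Qed.

Lemma size_col_word E f H j : size (col_word E f H j) = count (E j) (iota 1 H).
Proof. by rewrite size_map size_filter -(count_rev _ (iota 1 H)). Qed.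

(** * Straight tableaux are determined by their plactic class *)

Section Straight.

Variables (n W H : nat) (N : nat -> nat -> bool) (f : filling).
Hypotheses (dN : downset N) (oN : ordered n N f).

Lemma straight_aligned j : 0 < j ->
  aligned leq (rev (col_word N f H j)) (rev (col_word N f H j.+1)).
Proof.
move=> j0; rewrite /col_word !filter_rev !map_rev !revK.
apply: (@aligned_rows ltn).
- exact: ltn_trans.
- exact: iota_ltn_sorted.
- move=> s s'; rewrite !mem_iota => hs hs' ss h; apply: dN h _ _; lia.
- move=> s; rewrite mem_iota => hs h.
  have h' : N j s by apply: dN h _ _; lia.
  by split=> //; have := oN.2 _ _ _ _ h' h (leqnSn j) (leqnn s); rewrite ltnn addn0.
Qed.

Lemma straight_gain d :
  gain (nseq d 0) (word N f W H) (sumn [seq minn (count (N j) (iota 1 H)) d | j <- iota 1 W]).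
Proof.
pose col j := rev (col_word N f H j).
have p k j : 0 < j -> path (fun a b => aligned leq (take d a) (take d b)) (col j)
    [seq col a | a <- iota j.+1 k].
  elim: k j => [//|k IH] j j0 /=; rewrite IH // andbT.
  exact/aligned_take/straight_aligned.
(* A column of [d] zeros in front of the tableau provides the starting points of the rows. *)
have p0 : path (fun a b => aligned leq (take d a) (take d b)) (nseq d 0)
    [seq col a | a <- iota 1 W].
  case: W => [//|k] /=; rewrite p // andbT.
  by rewrite take_nseq //; elim: (d) (col 1) => [|e IH] [|x c] /=.
have := gain_rows [::] p0; rewrite take_nseq // cats0 -!map_comp.
have -> : [seq (rev \o col) i | i <- iota 1 W] = [seq col_word N f H j | j <- iota 1 W].
  by apply/eq_map => j /=; rewrite revK.
congr (gain _ _ (sumn _)); apply/eq_map => j /=.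
by rewrite size_rev size_col_word.
Qed.

End Straight.

Lemma word_gain_bound n W H E f X g : ordered n E f -> gain X (word E f W H) g ->
  g <= sumn [seq minn (count (E j) (iota 1 H)) (size X) | j <- iota 1 W].
Proof.
move=> o [Y /fam_flatten_bound h]; apply: leq_trans (h _) _.
  by apply/allP => _ /mapP [j _ ->]; exact: col_word_sorted o.
rewrite -map_comp; apply/eq_leq; congr sumn; apply/eq_map => j /=.
by rewrite size_col_word.
Qed.

Lemma count_initial (P : pred nat) m k : 0 < k <= m ->
  (forall a b, 0 < a <= b -> b <= m -> P b -> P a) ->
  P k = (k <= count P (iota 1 m)).
Proof.
move=> hk hP; rewrite -(subnKC (n := m) (m := k)); last by lia.
rewrite iotaD count_cat add1n; case: (boolP (P k)) => hPk.
  have -> : count P (iota 1 k) = k.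
    rewrite -[RHS](size_iota 1 k) -(count_predT (iota 1 k)).
    apply: eq_in_count => a; rewrite mem_iota => ha; apply: hP hPk; lia.
  by rewrite leq_addr.
have -> : count P (iota k.+1 (m - k)) = 0.
  apply/eqP; rewrite -leqn0 leqNgt -has_count; apply/hasP => -[b hb Pb].
  move: hb; rewrite mem_iota => hb; case/negP: hPk; apply: hP Pb; lia.
have -> : iota 1 k = rcons (iota 1 k.-1) k.
  by case: k hk {hPk} => [//|k] _; rewrite -cats1 -(addn1 k) iotaD addn1 add1n.
rewrite -cats1 count_cat /= (negPf hPk).
have := count_size P (iota 1 k.-1); rewrite size_iota; lia.
Qed.

Lemma sumn_minnS (c : nat -> nat) d s :
  sumn [seq minn (c j) d.+1 | j <- s] =
  sumn [seq minn (c j) d | j <- s] + count (fun j => d < c j) s.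
Proof. by elim: s => //= j s ->; lia. Qed.

Lemma filter_word E f W H t :
  [seq a <- word E f W H | a <= t] = word (fun j i => E j i && (f j i <= t)) f W H.
Proof.
rewrite /word filter_flatten -map_comp; congr flatten; apply/eq_map => j /=.
rewrite /col_word filter_map -filter_predI; congr map; apply: eq_filter => i /=.
by rewrite andbC.
Qed.

(** The maximal gain of [d] sequences is the number of boxes in the first [d] rows. It is a plactic
    invariant, and its successive differences in [d] are the row lengths. *)
Lemma straight_shape n W H N1 f1 N2 f2 :
  downset N1 -> downset N2 -> ordered n N1 f1 -> ordered n N2 f2 ->
  (forall j i, N1 j i -> 0 < j <= W /\ 0 < i <= H) ->
  (forall j i, N2 j i -> 0 < j <= W /\ 0 < i <= H) ->
  plactic (word N1 f1 W H) (word N2 f2 W H) ->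
  forall j i, N1 j i = N2 j i.
Proof.
move=> d1 d2 o1 o2 b1 b2 pl.
have sums d : sumn [seq minn (count (N1 j) (iota 1 H)) d | j <- iota 1 W]
            = sumn [seq minn (count (N2 j) (iota 1 H)) d | j <- iota 1 W].
  have g1 := straight_gain W H d1 o1 d; have g2 := straight_gain W H d2 o2 d.
  apply/eqP; rewrite eqn_leq.
  have := word_gain_bound o2 ((plactic_gain pl _ _).1 g1).
  have := word_gain_bound o1 ((plactic_gain pl _ _).2 g2).
  by rewrite !size_nseq => -> ->.
move=> j i; case: (boolP ((0 < j <= W) && (0 < i <= H))) => hji; last first.
  have -> : N1 j i = false by apply: contraNF hji => /b1 [-> ->].
  by apply/esym; apply: contraNF hji => /b2 [-> ->].
have row N : downset N -> (forall j i, N j i -> 0 < j <= W /\ 0 < i <= H) ->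
   N j i = (j <= count (fun j => i.-1 < count (N j) (iota 1 H)) (iota 1 W)).
  move=> dN bN.
  have col a : (i.-1 < count (N a) (iota 1 H)) = N a i.
    rewrite prednK; last by lia.
    apply/esym/count_initial; first by lia.
    by move=> b c hb hc h; have [? ?] := bN _ _ h; apply: dN h _ _; lia.
  rewrite (eq_count col).
  apply: (@count_initial (fun a => N a i)); first by lia.
  by move=> b c hb hc h; have [? ?] := bN _ _ h; apply: dN h _ _; lia.
rewrite (row N1) // (row N2) //; congr (_ <= _).
by have := sums i.-1.+1; rewrite !sumn_minnS sums => /addnI.
Qed.

(** For each [t], the boxes with entries at most [t] form a straight tableau whose word is the
    filtered word, so [straight_shape] determines these boxes. Letting [t] vary recovers the
    entries. *)
Lemma straight_unique n W H N1 f1 N2 f2 :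
  downset N1 -> downset N2 -> ordered n N1 f1 -> ordered n N2 f2 ->
  (forall j i, N1 j i -> 0 < j <= W /\ 0 < i <= H) ->
  (forall j i, N2 j i -> 0 < j <= W /\ 0 < i <= H) ->
  plactic (word N1 f1 W H) (word N2 f2 W H) ->
  forall j i, N1 j i = N2 j i /\ (N1 j i -> f1 j i = f2 j i).
Proof.
move=> d1 d2 o1 o2 b1 b2 pl.
have restr N f t : downset N -> ordered n N f ->
    downset (fun j i => N j i && (f j i <= t)) /\
    ordered n (fun j i => N j i && (f j i <= t)) f.
  move=> dN [h1 h2]; split.
    move=> j i j' i' /andP [nn ft] hj hi; have h := dN _ _ _ _ nn hj hi.
    by rewrite h; have := h2 _ _ _ _ h nn; lia.
  split=> [j i /andP [h _]|j i j' i' /andP [h _] /andP [h' _]]; auto.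
have key t j i : N1 j i && (f1 j i <= t) = N2 j i && (f2 j i <= t).
  have [e1 e2] := restr _ _ t d1 o1; have [e3 e4] := restr _ _ t d2 o2.
  apply: (straight_shape e1 e3 e2 e4).
  - by move=> a b /andP [h _]; exact: b1.
  - by move=> a b /andP [h _]; exact: b2.
  - by rewrite -!filter_word; exact: plactic_filter.
have eN := straight_shape d1 d2 o1 o2 b1 b2 pl.
move=> j i; split=> // h.
have := key (f1 j i) j i; have := key (f2 j i) j i.
by rewrite -eN h !leqnn /= => h1 h2; apply/eqP; rewrite eqn_leq h1 -h2.
Qed.

(** * Uniqueness of the last column *)

Section LastColumn.

Variables (d : nat).

Let full (cs : seq (seq nat)) := sumn [seq minn (size c) d | c <- cs].

(** A family of maximal gain on the first word ends exactly in [C1], so a further copy of [C1] gains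
    [d] once more. On the second word such a family must end exactly in [C2] before that copy, and
    the letters of [C2] are then raised to those of [C1]. *)
Lemma last_column_le cs1 C1 cs2 C2 :
  all (sorted gtn) cs1 -> all (sorted gtn) cs2 -> sorted gtn C1 -> sorted gtn C2 ->
  size C1 = d -> size C2 = d -> full cs1 = full cs2 ->
  plactic (flatten cs1 ++ C1) (flatten cs2 ++ C2) ->
  gain (nseq d 0) (flatten cs1 ++ C1) (full cs1 + d) ->
  sumn C2 <= sumn C1 /\ (sumn C1 <= sumn C2 -> perm_eq C2 C1).
Proof.
move=> s1 s2 sC1 sC2 z1 z2 ef pl [Y /fam_cat [g1 [g2 [Z [eg h1 h2]]]]].
have b1 := fam_flatten_bound s1 h1; rewrite size_nseq -/(full cs1) in b1.
have zZ : size Z = d by rewrite (fam_size h1) size_nseq.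
have b2 := fam_column_bound sC1 h2; rewrite z1 zZ minnn in b2.
have eg2 : g2 = size C1 by lia.
rewrite eg2 in h2; have [|pY _ _] := fam_column_full sC1 _ h2; first by lia.
have h3 : fam Y C1 (size C1) C1.
  apply: (@fam_perm C1); first by rewrite perm_sym.
  have : all2 leq C1 C1 by clear; elim: C1 => //= a s ->; rewrite leqnn.
  by move/(fam_replace [::]); rewrite !cats0.
have /(plactic_gain (plactic_catr C1 pl)) : gain (nseq d 0) ((flatten cs1 ++ C1) ++ C1) (full cs1 + d + d).
  exists C1; apply/fam_cat; exists (g1 + g2), d, Y; split; first by rewrite eg.
    by apply/fam_cat; exists g1, g2, Z; rewrite eg2.
  by rewrite -{1}z1.
move=> [U /fam_cat [k1 [k2 [V [ek /fam_cat [k3 [k4 [V' [ek' f1 f2]]]] f3]]]]].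
have b3 := fam_flatten_bound s2 f1; rewrite size_nseq -/(full cs2) in b3.
have zV' : size V' = d by rewrite (fam_size f1) size_nseq.
have b4 := fam_column_bound sC2 f2; rewrite z2 zV' minnn in b4.
have zV : size V = d by rewrite (fam_size f2).
have b5 := fam_column_bound sC1 f3; rewrite z1 zV minnn in b5.
(* The bounds [b3], [b4] and [b5] add up to exactly the total gain, so each of them is an
   equality. *)
have ek4 : k4 = size C2 by lia.
have ek2 : k2 = size C1 by lia.
rewrite ek4 in f2; rewrite ek2 in f3.
have [|pV _ _] := fam_column_full sC2 _ f2; first by lia.
have [|_ le eq] := fam_column_full sC1 _ f3; first by lia.
by move: le eq; rewrite (perm_sumn pV) (permPl pV).
Qed.

Lemma last_column_unique cs1 C1 cs2 C2 :
  all (sorted gtn) cs1 -> all (sorted gtn) cs2 -> sorted gtn C1 -> sorted gtn C2 ->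
  size C1 = d -> size C2 = d -> full cs1 = full cs2 ->
  plactic (flatten cs1 ++ C1) (flatten cs2 ++ C2) ->
  gain (nseq d 0) (flatten cs1 ++ C1) (full cs1 + d) -> C1 = C2.
Proof.
move=> s1 s2 sC1 sC2 z1 z2 ef pl g.
have [le eq] := last_column_le s1 s2 sC1 sC2 z1 z2 ef pl g.
have g' := (plactic_gain pl _ _).1 g; rewrite ef in g'.
have [le' _] := last_column_le s2 s1 sC2 sC1 z2 z1 (esym ef) (plactic_sym pl) g'.
apply: (irr_sorted_eq gtn_trans) => // [x|]; first exact: ltnn.
by apply: perm_mem; rewrite perm_sym; exact: eq.
Qed.

End LastColumn.

Lemma plactic_perm w w' : plactic w w' -> perm_eq w w'.
Proof.
elim=> {w w'} [w|w w' _|w1 w2 w3 _ h1 _ h2|u v x y z _ _|u v x y z _ _] //.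
- by rewrite perm_sym.
- exact: perm_trans h1 h2.
- by rewrite perm_cat2l perm_cat2r perm_swap.
- by rewrite perm_cat2l perm_cat2r perm_cons perm_swap.
Qed.

(** * Skew tableaux with prescribed columns *)

Lemma filter_iota_mid a b H : a + b <= H ->
  [seq i <- iota 1 H | a < i <= a + b] = iota a.+1 b.
Proof.
move=> h; have -> : H = a + (b + (H - (a + b))) by lia.
rewrite !iotaD !filter_cat add1n addSn.
rewrite (@eq_in_filter _ _ xpred0) ?filter_pred0 /=; last first.
  by move=> i; rewrite mem_iota; clear; lia.
rewrite (@eq_in_filter _ _ xpredT) ?filter_predT; last first.
  by move=> i; rewrite mem_iota; clear; lia.
rewrite [X in _ ++ X](@eq_in_filter _ _ xpred0) ?filter_pred0 ?cats0 //.
by move=> i; rewrite mem_iota; clear; lia.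
Qed.

Lemma skew_box_col S j i : is_partition (inner S) -> is_partition (outer S) ->
  0 < j -> skew_box S j i = (col_len (inner S) j < i <= col_len (outer S) j).
Proof. by move=> pi po j0; rewrite /skew_box !box_col //; lia. Qed.

Lemma inner_col_le S j : is_partition (inner S) -> is_partition (outer S) ->
  (forall i, row_len (inner S) i <= row_len (outer S) i) -> 0 < j ->
  col_len (inner S) j <= col_len (outer S) j.
Proof.
move=> pi po hio j0; case: (posnP (col_len (inner S) j)) => [-> //|c0].
have : box (inner S) j (col_len (inner S) j) by rewrite box_col // c0 leqnn.
case/and3P => _ _ h.
have : box (outer S) j (col_len (inner S) j) by rewrite /box j0 c0 (leq_trans h).
by rewrite box_col // => /andP [].
Qed.

Lemma skew_col_word n S H j : semistandard_skew n S -> size (outer S) <= H -> 0 < j ->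
  col_word (skew_box S) (entry S) H j =
  rev [seq entry S j (col_len (inner S) j + i) | i <- iota 1 (skew_col_len S j)].
Proof.
move=> [pi po hio _] hH j0; have le := inner_col_le pi po hio j0.
rewrite /col_word filter_rev map_rev; congr rev.
rewrite (eq_filter (a2 := fun i => col_len (inner S) j < i <= col_len (inner S) j + skew_col_len S j)).
  rewrite filter_iota_mid; last first.
    by rewrite subnKC //; apply: leq_trans hH; exact: count_size.
  by rewrite -addn1 iotaDl -map_comp.
by move=> i; rewrite skew_box_col // /skew_col_len subnKC.
Qed.

(** The conjugate partition: the shape with column lengths [hs]. [H] is chosen at least the longest
    column, and trailing zero rows may occur. *)
Definition conj_part (hs : seq nat) (H : nat) : seq nat :=
  [seq col_len hs i | i <- iota 1 H].

Lemma row_len_conj hs H i : 0 < i <= H -> row_len (conj_part hs H) i = col_len hs i.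
Proof.
move=> hi; have h : i.-1 < H by lia.
by rewrite /row_len (nth_map 0) ?size_iota // nth_iota // add1n prednK //; lia.
Qed.

Lemma conj_partition hs H : is_partition (conj_part hs H).
Proof.
apply: partition_intro => i i0; have [h|h] := leqP i.+1 H; last first.
  by rewrite {1}/row_len nth_default // size_map size_iota.
rewrite !row_len_conj; try lia.
by apply: sub_count => a /=; lia.
Qed.

Lemma box_conj hs H j i : is_partition hs -> row_len hs 1 <= H -> 0 < j ->
  box (conj_part hs H) j i = (0 < i <= row_len hs j).
Proof.
move=> phs hH j0; rewrite /box j0 /=; case: (posnP i) => [-> //|i0] /=.
have := row_len_anti phs j0.
have [h|h] := leqP i H; last first.
  have -> : row_len (conj_part hs H) i = 0.
    by rewrite /row_len nth_default ?size_map ?size_iota //; lia.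
  lia.
by rewrite row_len_conj ?i0 // => _; have := box_col j phs i0; rewrite /box i0 j0.
Qed.

Lemma col_len_conj hs H j : is_partition hs -> row_len hs 1 <= H -> 0 < j ->
  col_len (conj_part hs H) j = row_len hs j.
Proof.
move=> phs hH j0; have e i := box_conj i phs hH j0.
have e' i := box_col i (conj_partition hs H) j0.
apply/eqP; rewrite eqn_leq.
have := e (row_len hs j); have := e (col_len (conj_part hs H) j).
rewrite !e' !leqnn; lia.
Qed.

(* Each column is placed entirely above and to the right of the previous one,
   so that only the columns constrain the entries. *)
Lemma skew_of_columns n cs C : all (sorted gtn) (rcons cs C) ->
  all (all (fun x => 1 <= x <= n)) (rcons cs C) -> 0 < size C ->
  exists S, [/\ semistandard_skew n S, ncols (outer S) = (size cs).+1,
    forall H, size (outer S) <= H ->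
      word (skew_box S) (entry S) (size cs).+1 H = flatten (rcons cs C),
    skew_col_lens S = [seq size c | c <- rcons cs C]
  & forall i, last_col S i = nth 0 (rev C) i.-1].
Proof.
move=> srt bnd C0; set ds := rcons cs C in srt bnd *.
have zds : size ds = (size cs).+1 by rewrite size_rcons.
(* The total length of the columns from position [k] on, counted from 0. Column [j], counted from 1,
   occupies the rows from [suf j + 1] to [suf j.-1]. *)
pose suf k := sumn [seq size c | c <- drop k ds].
have sufS k : k < size ds -> suf k = size (nth [::] ds k) + suf k.+1.
  by move=> hk; rewrite /suf (drop_nth [::]).
have suf_anti k : suf k.+1 <= suf k.
  have [h|h] := ltnP k (size ds); first by rewrite (sufS k) // leq_addl.
  by rewrite /suf drop_oversize //; lia.
have suf0 k : size ds <= k -> suf k = 0 by move=> h; rewrite /suf drop_oversize.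
pose ho := mkseq suf (size ds); pose hi := mkseq (suf \o succn) (size ds).
have rowo j : 0 < j -> row_len ho j = suf j.-1.
  move=> j0; rewrite /row_len; have [h|h] := ltnP j.-1 (size ds); first by rewrite nth_mkseq.
  by rewrite nth_default ?size_mkseq // suf0.
have rowi j : 0 < j -> row_len hi j = suf j.
  move=> j0; rewrite /row_len; have [h|h] := ltnP j.-1 (size ds).
    by rewrite nth_mkseq //= prednK.
  by rewrite nth_default ?size_mkseq // suf0 //; lia.
have po : is_partition ho.
  by apply: partition_intro => i i0; rewrite !rowo //=; have := suf_anti i.-1; rewrite prednK.
have pi : is_partition hi by apply: partition_intro => i i0; rewrite !rowi.
pose e j i := nth 0 (rev (nth [::] ds j.-1)) (i - suf j).-1.
pose S := Skew (conj_part hi (suf 0)) (conj_part ho (suf 0)) e.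
have co j : 0 < j -> col_len (outer S) j = suf j.-1.
  by move=> j0; rewrite col_len_conj // rowo.
have ci j : 0 < j -> col_len (inner S) j = suf j.
  by move=> j0; rewrite col_len_conj // rowi.
have sb j i : 0 < j -> skew_box S j i = (suf j < i <= suf j.-1).
  by move=> j0; rewrite skew_box_col ?co ?ci //; exact: conj_partition.
have sufj j : 0 < j -> suf j.-1 = size (nth [::] ds j.-1) + suf j.
  move=> j0; have [h|h] := ltnP j.-1 (size ds).
    by rewrite (sufS j.-1) // prednK.
  by rewrite !suf0 ?nth_default //; lia.
have colds j i : 0 < j -> skew_box S j i -> (i - suf j).-1 < size (nth [::] ds j.-1).
  by move=> j0; rewrite sb // sufj //; lia.
have ss : semistandard_skew n S.
  split=> [||i|].
  - exact: conj_partition.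
  - exact: conj_partition.
  - have hrow a : 0 < a -> row_len (inner S) a <= row_len (outer S) a.
      move=> a0; have [h|h] := leqP a (suf 0); last first.
        by rewrite {1}/row_len nth_default // size_map size_iota; lia.
      rewrite /= !row_len_conj ?a0 //.
      case: (posnP (col_len hi a)) => [-> //|c0].
      have : box hi a (col_len hi a) by rewrite box_col // c0 leqnn.
      rewrite /box a0 c0 rowi //= => h1.
      have : box ho a (col_len hi a).
        by rewrite /box a0 c0 rowo //=; apply: leq_trans h1 _; have := suf_anti (col_len hi a).-1; rewrite prednK.
      by rewrite box_col // => /andP [].
    by case: i => [|i]; [exact: (hrow 1)|exact: hrow].
  split=> j i h.
  - have j0 : 0 < j by case/andP: h => /and3P [].
    have hsz := colds _ _ j0 h.
    have hj : j.-1 < size ds.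
      by rewrite ltnNge; apply/negP => hj; rewrite nth_default in hsz.
    have /allP /(_ _ (mem_nth [::] hj)) /allP := bnd; apply.
    by rewrite -mem_rev mem_nth // size_rev.
  - have j0 : 0 < j by case/andP: h => /and3P [].
    move=> h'; move: h h'; rewrite (sb j i j0) (sb j.+1 i) //=; lia.
  - move=> h'; have j0 : 0 < j by case/andP: h => /and3P [].
    have hsz := colds _ _ j0 h'.
    have hj : j.-1 < size ds.
      by rewrite ltnNge; apply/negP => hj; rewrite nth_default in hsz.
    have /allP /(_ _ (mem_nth [::] hj)) := srt.
    rewrite -rev_sorted => /(sorted_ltn_nth ltn_trans 0); rewrite /e; apply.
    + rewrite inE size_rev; exact: colds.
    + by rewrite inE size_rev.
    + by move: h; rewrite (sb j i j0) => h; rewrite /=; lia.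
(* As [C] is nonempty, [suf k] is positive for all [k < size ds], so every column of the list
   reaches the first row of the outer shape. *)
have nc : ncols (outer S) = (size cs).+1.
  have s1 k : (suf k != 0) = (k < size ds).
    have [h|h] := ltnP k (size ds); last by rewrite suf0.
    have -> : suf k = size C + sumn [seq size c | c <- drop k cs].
      rewrite /suf /ds drop_rcons; last by rewrite -ltnS -zds.
      by rewrite map_rcons sumn_rcons addnC.
    by lia.
  have b1 j : 0 < j -> box (outer S) j 1 = (j.-1 < size ds).
    move=> j0; rewrite box_col //; last exact: conj_partition.
    by rewrite co // -s1 -lt0n.
  apply/eqP; rewrite eqn_leq -zds.
  have := b1 (size cs).+1 isT; rewrite /box zds /= ltnSn -/(ncols (outer S)) => ->.
  rewrite andbT; case: (posnP (ncols (outer S))) => [-> //|c0].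
  by have := b1 _ c0; rewrite /box c0 -/(ncols (outer S)) leqnn /= zds; lia.
have lens j : 0 < j -> skew_col_len S j = size (nth [::] ds j.-1).
  by move=> j0; rewrite /skew_col_len co // ci // sufj // addnK.
have mapds (A : Type) (g : seq nat -> A) :
    [seq g (nth [::] ds j.-1) | j <- iota 1 (size cs).+1] = [seq g c | c <- ds].
  rewrite -zds -[iota 1 _]/(iota (1 + 0) _) iotaDl -map_comp.
  by rewrite -[in RHS](mkseq_nth [::] ds) /mkseq -map_comp; apply/eq_map.
exists S; split=> //.
- move=> H hH; rewrite /word -[in RHS](map_id ds) -mapds; congr flatten.
  apply/eq_in_map => j; rewrite mem_iota => /andP [j0 _].
  rewrite (skew_col_word ss hH j0) lens // ci //.
  rewrite -[RHS]revK; congr rev; set c := nth [::] ds j.-1.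
  apply: (@eq_from_nth _ 0); first by rewrite size_map size_iota size_rev.
  move=> i; rewrite size_map size_iota => hi'.
  rewrite (nth_map 0) ?size_iota // nth_iota // /S /= /e -/c; congr nth; lia.
- rewrite /skew_col_lens nc -mapds; apply/eq_in_map => j.
  by rewrite mem_iota => /andP [j0 _]; exact: lens.
- move=> i; rewrite /last_col nc ci // suf0 ?zds // /S /= /e.
  by rewrite suf0 ?zds // subn0 add0n /ds nth_rcons ltnn eqxx.
Qed.

(** * Scanning as column exchange *)

Fixpoint sweep (X : seq nat) (cs : seq (seq nat)) : seq (seq nat) * seq nat :=
  if cs is c :: cs' then
    let: (D, E) := exchange X c in
    let: (Ds, F) := sweep E cs' in (D :: Ds, F)
  else ([::], X).

Definition top_aligned (c c' : seq nat) : bool := aligned leq (rev c) (rev c').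

(** [c] is the tableau column just left of [cs], and it is contained in the travelling column [X].
    Its top entries are at most those of the next column, so that column is matched completely and
    is in turn contained in the new travelling column. *)
Lemma sweep_spec X c cs : subseq c X -> path top_aligned c cs ->
  sorted gtn X -> all (sorted gtn) cs ->
  [/\ plactic (X ++ flatten cs) (flatten (sweep X cs).1 ++ (sweep X cs).2),
      [seq size a | a <- (sweep X cs).1] = [seq size a | a <- cs],
      all (sorted gtn) (sweep X cs).1, sorted gtn (sweep X cs).2
    & size (sweep X cs).2 = size X].
Proof.
elim: cs c X => [|c' cs IH] c X sub /=; first by rewrite cats0.
move=> /andP [al p] sX /andP [sc' scs].
have [|||sz sub'] := @exchange_matched X c' (rev (take (size c') (rev c))).
- apply: subseq_trans sub; rewrite -[c in subseq _ c]revK subseq_rev; exact: take_subseq.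
- rewrite size_rev; have := aligned_all2 al.
  by rewrite size_rev all2E => /andP [/eqP -> _]; rewrite size_rev.
- by have := all2_rev (aligned_all2 al); rewrite size_rev revK.
have pl := plactic_exchange sX sc' sz.
have sE := exchange_sorted sX sc'; have zE := exchange_size2 X c'.
have sD := subseq_sorted gtn_trans (exchange_subseq X c') sX.
case: (exchange X c') sz sub' pl sE zE sD => D E /= sz sub' pl sE zE sD.
have [] := IH c' E sub' p sE scs.
case: (sweep E cs) => Ds F /= pl2 e2 a2 s2 z2; split=> //.
- rewrite catA; apply: plactic_trans (plactic_catr _ pl) _.
  by rewrite -!catA; exact: plactic_catl.
- by rewrite sz e2.
- by rewrite sD.
- by rewrite z2.
Qed.

(** The last value of the earliest weakly increasing subsequence of the bottoms of the columns [js],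
    continued from the value [x]. *)
Definition run (T : filling) (h : nat -> nat) (x : nat) (js : seq nat) : nat :=
  foldl (fun x j => if (0 < h j) && (x <= T j (h j)) then T j (h j) else x) x js.

Lemma run_max T h x js :
  run T h x js = maxn x (\max_(b <- [seq (j, h j) | j <- js & 0 < h j]) value_at T b).
Proof.
elim: js x => [|j js IH] x /=; first by rewrite big_nil maxn0.
rewrite -/(run T h _ js) IH; case: (0 < h j) => //=.
rewrite big_cons /value_at /= maxnA; congr maxn.
by rewrite /maxn; case: ltngtP.
Qed.

Lemma ewis_after_mem T (h : nat -> nat) x js j : uniq js -> j \in js ->
  ((j, h j) \in ewis_after (value_at T) x [seq (a, h a) | a <- js & 0 < h a]) =
  (0 < h j) && (run T h x (take (index j js) js) <= T j (h j)).
Proof.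
have notin x' s a : a \notin s ->
    ((a, h a) \in ewis_after (value_at T) x' [seq (b, h b) | b <- s & 0 < h b]) = false.
  move=> ha; apply: contraNF ha.
  elim: s x' => //= b s IH x'; rewrite inE; case: (0 < h b) => /=; last first.
    by move=> /IH ->; rewrite orbT.
  case: ifP => _; last by move=> /IH ->; rewrite orbT.
  by rewrite inE => /orP [/eqP [-> _]|/IH ->]; rewrite ?eqxx ?orbT.
elim: js x => //= a js IH x /andP [ajs u]; rewrite inE eq_sym.
have [<-|ne] /= := eqVneq a j => [_|jjs].
  case: (0 < h a) => //=; last exact: notin.
  rewrite /value_at /=; case: ifP => hx; first by rewrite mem_head.
  exact: notin.
rewrite -/(run T h _ _); case: (0 < h a) => /=; last by rewrite IH.
rewrite {1}/value_at /=; case: ifP => hx; last by rewrite IH.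
rewrite inE IH // xpair_eqE eq_sym (negPf ne) /=.
by [].
Qed.

Lemma remove_path_run lam T l h j : l <= j <= ncols lam ->
  remove_path lam T l h j =
  if (0 < h j) && (run T h 0 (iota l (j - l)) <= T j (h j)) then (h j).-1 else h j.
Proof.
move=> hj; rewrite /remove_path /scan_path.
(* The first bottom is always chosen, which amounts to starting after the value 0. *)
have -> : ewis (value_at T) (bottoms lam l h) = ewis_after (value_at T) 0 (bottoms lam l h).
  by rewrite /ewis; case: (bottoms lam l h).
rewrite /bottoms ewis_after_mem ?iota_uniq //; last by rewrite mem_iota; lia.
have -> : index j (iota l ((ncols lam).+1 - l)) = j - l.
  have hn : j - l < (ncols lam).+1 - l by lia.
  have {1}-> : j = nth 0 (iota l ((ncols lam).+1 - l)) (j - l) by rewrite nth_iota //; lia.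
  by rewrite index_uniq ?size_iota ?iota_uniq.
by rewrite take_iota; have -> : minn (j - l) ((ncols lam).+1 - l) = j - l by lia.
Qed.

(** In scanning round [a] the value [x a] arrives at a column whose bottom is at height [h a]. The
    letters that [exchange] has not yet matched are those at heights 1 to [h a], so it makes the
    same choice as the scanning path. *)
Lemma exchange_scan (T : nat -> nat) (h x : nat -> nat) k m :
  (forall m, h m.+1 = if (0 < h m) && (x m <= T (h m)) then (h m).-1 else h m) ->
  (exchange [seq x a | a <- iota m k] [seq T i | i <- rev (iota 1 (h m))]).2 =
  [seq if (0 < h a) && (x a <= T (h a)) then T (h a) else x a | a <- iota m k].
Proof.
move=> hh; have e0 c : rev (iota 1 c.+1) = c.+1 :: rev (iota 1 c).
  by rewrite -(addn1 c) iotaD rev_cat addn1 add1n.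
elim: k m => [|k IH] m //=.
have := IH m.+1; rewrite hh; case hm: (h m) => [|c] /=.
  by case: k {IH} => [//|k] /= <-.
rewrite e0 /=; case: ifP => _ /=.
  by case: (exchange _ _) => D E /= ->.
rewrite e0 /=; by case: (exchange _ _) => D E /= ->.
Qed.

Definition scan_value (lam : seq nat) (T : filling) (l k : nat) : nat :=
  maxn (T l k) (m_U lam T l k).

Lemma rev_iota_sub d : rev (iota 1 d) = [seq d - a | a <- iota 0 d].
Proof.
apply: (@eq_from_nth _ 0); first by rewrite size_rev size_map !size_iota.
move=> i; rewrite size_rev size_iota => hi.
rewrite nth_rev ?size_iota // (nth_map 0) ?size_iota // !nth_iota //; lia.
Qed.

Lemma box_col_word lam T H j : is_partition lam -> size lam <= H -> 0 < j ->
  col_word (box lam) T H j = [seq T j i | i <- rev (iota 1 (col_len lam j))].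
Proof.
move=> pl hH j0; rewrite /col_word filter_rev.
rewrite (eq_filter (a2 := fun i => 0 < i <= 0 + col_len lam j)).
  by rewrite filter_iota_mid // add0n; apply: leq_trans hH; exact: count_size.
by move=> i; rewrite add0n box_col.
Qed.

(** * The last column after sweeping a column through the tableau *)

Section Scan.

Variables (n : nat) (lam : seq nat) (T : filling) (H l : nat).
Hypotheses (plam : is_partition lam) (hT : semistandard n lam T).
Hypotheses (hH : size lam <= H) (hl : 0 < l <= ncols lam).

Let W := ncols lam.
Let d := col_len lam l.
Let h a := iter a (remove_path lam T l) (col_len lam).
Let col j := col_word (box lam) T H j.

Lemma box_ordered : ordered n (box lam) T.
Proof.
have dN := downset_box plam.
have d0 : downset (fun _ _ => false) by [].
have e j i : diff (box lam) (fun _ _ => false) j i = box lam j i.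
  by rewrite /diff andbT.
have /(semistandard_ordered n T dN d0) : forall j i, box lam j i -> 0 < j /\ 0 < i.
  by move=> j i /and3P [].
case: hT => h1 h2 h3 [].
case=> [|o1 o2 _].
  split=> [j i|j i|j i]; rewrite !e; auto.
by split=> [j i|j i j' i']; rewrite -!e; auto.
Qed.

Lemma heights_left a : h a l = d - a.
Proof.
elim: a => [|a IH]; first by rewrite subn0.
rewrite /h iterS -/(h a) remove_path_run; last by rewrite leqnn; case/andP: hl.
by rewrite subnn /= IH andbT; case: ifP; lia.
Qed.

(** Scanning follows one path through all columns, while [sweep] passes all letters through one
    column at a time. The invariant reconciling them: before column [j], the travelling letter for
    round [a] is the last value of path [a] on the columns from [l] to [j - 1]. *)
Lemma sweep_run r j : l <= j -> j + r = W.+1 ->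
  (sweep [seq run T (h a) 0 (iota l (j - l)) | a <- iota 0 d]
         [seq col i | i <- iota j r]).2
  = [seq run T (h a) 0 (iota l (W.+1 - l)) | a <- iota 0 d].
Proof.
elim: r j => [|r IH] j lj /= e; first by rewrite addn0 in e; rewrite e.
have := @exchange_scan (T j) (fun a => h a j)
  (fun a => run T (h a) 0 (iota l (j - l))) d 0.
have -> : [seq T j i | i <- rev (iota 1 (h 0 j))] = col j.
  by rewrite /col box_col_word //; lia.
have -> : [seq (if (0 < h a j) && (run T (h a) 0 (iota l (j - l)) <= T j (h a j))
      then T j (h a j) else run T (h a) 0 (iota l (j - l))) | a <- iota 0 d]
    = [seq run T (h a) 0 (iota l (j.+1 - l)) | a <- iota 0 d].
  apply/eq_map => a; rewrite subSn // -(addn1 (j - l)) iotaD /run foldl_cat /= subnKC //.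
have hh m : h m.+1 j = if (0 < h m j) && (run T (h m) 0 (iota l (j - l)) <= T j (h m j))
    then (h m j).-1 else h m j.
  by rewrite /h iterS remove_path_run // lj /=; lia.
move=> /(_ hh); case: (exchange _ _) => D E /= ->.
have := IH j.+1 (leqW lj); rewrite addSnnS => /(_ e).
by case: (sweep _ _).
Qed.

Lemma sweep_scan :
  (sweep (col l) [seq col j | j <- iota l.+1 (W - l)]).2
  = [seq scan_value lam T l k | k <- rev (iota 1 d)].
Proof.
have l0 : 0 < l by case/andP: hl.
have := @sweep_run (W - l) l.+1 (leqnSn l).
rewrite subSnn addSn subnKC => [/(_ erefl)|]; last by case/andP: hl.
have -> : [seq run T (h a) 0 (iota l 1) | a <- iota 0 d] = col l.
  rewrite /col box_col_word // rev_iota_sub -map_comp; apply/eq_in_map => a.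
  by rewrite mem_iota /run /= heights_left subn_gt0 => ->.
move=> ->; rewrite rev_iota_sub -map_comp; apply/eq_in_map => a.
rewrite mem_iota => ha; have ha' : 0 < d - a by lia.
have -> : W.+1 - l = (W - l).+1 by rewrite subSn //; case/andP: hl.
rewrite /run /= -/(run T _ _ _) heights_left ha' /= run_max /scan_value.
rewrite /m_U /heights -/d subKn; last by lia.
rewrite -/(h a) /bottoms subSS -/W.
(* If no box remains to the right, [m_U] is 1 by convention and is absorbed by the maximum, because
   the entries of [T] are at least 1. *)
case e : [seq (j, h a j) | j <- iota l.+1 (W - l) & 0 < h a j] => [|b s] //.
rewrite big_nil maxn0; apply/esym/maxn_idPl.
case: hT => /(_ l (d - a)) hb _ _.
have : box lam l (d - a) by rewrite box_col // ha' leq_subr.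
by move/hb => /andP [].
Qed.

Lemma scan_column : exists cs,
  [/\ all (sorted gtn) (rcons cs [seq scan_value lam T l k | k <- rev (iota 1 d)]),
      perm_eq [seq size c | c <- rcons cs [seq scan_value lam T l k | k <- rev (iota 1 d)]]
        (col_lens lam)
    & plactic (word (box lam) T W H)
        (flatten (rcons cs [seq scan_value lam T l k | k <- rev (iota 1 d)]))].
Proof.
have l0 : 0 < l by case/andP: hl.
have o := box_ordered; have dN := downset_box plam.
have ssort s : all (sorted gtn) [seq col j | j <- s].
  by apply/allP => _ /mapP [j _ ->]; exact: col_word_sorted o.
have p k j : 0 < j -> path top_aligned (col j) [seq col a | a <- iota j.+1 k].
  elim: k j => [//|k IH] j j0 /=; rewrite IH // andbT.
  exact: (straight_aligned H dN o j0).
have [] := sweep_spec (subseq_refl (col l)) (p (W - l) l l0)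
  (col_word_sorted H l o) (ssort (iota l.+1 (W - l))).
rewrite sweep_scan; set C := map _ _; set Ds := (sweep _ _).1 => pl sz sD sC zC.
have split_cols : iota 1 W = iota 1 l.-1 ++ l :: iota l.+1 (W - l).
  have -> : W = l.-1 + (W - l).+1 by case/andP: hl; lia.
  rewrite iotaD /=; congr (_ ++ _ :: iota _ _); lia.
exists ([seq col j | j <- iota 1 l.-1] ++ Ds); split.
- by rewrite all_rcons all_cat ssort sD sC.
- have zcol s : (forall j, j \in s -> 0 < j) ->
      [seq size (col j) | j <- s] = [seq col_len lam j | j <- s].
    move=> hs; apply/eq_in_map => j /hs j0.
    by rewrite /col box_col_word // size_map size_rev size_iota.
  have -> : col_lens lam = [seq size (col j) | j <- iota 1 W].
    by rewrite zcol // => j; rewrite mem_iota => /andP [].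
  rewrite split_cols map_rcons !map_cat sz /= zC -map_comp -map_comp -cats1 -catA.
  by rewrite perm_cat2l cats1 perm_rcons.
- rewrite /word -/col split_cols map_cat /= -cats1 -catA !flatten_cat /= cats0.
  exact: plactic_catl.
Qed.

End Scan.

(** * The right key *)

Lemma fits_box W H nu : is_partition nu -> ncols nu <= W -> size nu <= H -> fits W H nu.
Proof. by move=> p hW hH j i /(box_bound p); lia. Qed.

Lemma sumn_full_last d (cs : seq (seq nat)) C s : size C = d ->
  perm_eq [seq size c | c <- rcons cs C] s ->
  sumn [seq minn (size c) d | c <- cs] + d = sumn [seq minn a d | a <- s].
Proof.
move=> zC p; rewrite -(perm_sumn (perm_map (fun a => minn a d) p)).
by rewrite -map_comp map_rcons sumn_rcons /= zC minnn.
Qed.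

Lemma right_key_unique n lam T l S i :
  is_partition lam -> semistandard n lam T -> 0 < l <= ncols lam ->
  semistandard_skew n S -> rectifies_to lam T S ->
  perm_eq (skew_col_lens S) (col_lens lam) ->
  skew_col_len S (ncols (outer S)) = col_len lam l ->
  1 <= i <= col_len lam l -> last_col S i = scan_value lam T l i.
Proof.
move=> pl hT hl ss rect pS zS hi.
set W := ncols lam; set d := col_len lam l in zS hi *.
pose H := maxn (size lam) (size (outer S)).
have hH : size lam <= H by exact: leq_maxl.
have hH' : size (outer S) <= H by exact: leq_maxr.
have [pi po hio _] := ss.
have eW : ncols (outer S) = W by have := perm_size pS; rewrite !size_map !size_iota.
have W0 : 0 < W by lia.
have := rectifies_plactic rect ss (fits_box po (eq_leq eW) hH').
have [cs [scs pcs pls]] := scan_column pl hT hH hl.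
set C := map _ _ in scs pcs pls; rewrite -/W in pls.
have zC : size C = d by rewrite size_map size_rev size_iota.
have iW : iota 1 W = rcons (iota 1 W.-1) W.
  by rewrite -{1}(prednK W0) -(addn1 W.-1) iotaD -cats1 add1n prednK.
rewrite /word -/(word (box lam) T W H) iW map_rcons.
set cs' := [seq _ | _ <- _]; set C' := col_word _ _ _ _ => plS.
have eC' : C' = rev [seq last_col S k | k <- iota 1 d].
  by rewrite /C' (skew_col_word ss hH' W0) -zS /last_col eW.
have pcs' : perm_eq [seq size c | c <- rcons cs' C'] (col_lens lam).
  apply: perm_trans pS; rewrite /skew_col_lens eW iW !map_rcons.
  have -> : [seq size c | c <- cs'] = [seq skew_col_len S j | j <- iota 1 W.-1].
    rewrite -map_comp; apply/eq_in_map => j; rewrite mem_iota => /andP [j0 _] /=.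
    by rewrite (skew_col_word ss hH' j0) size_rev size_map size_iota.
  by rewrite eC' size_rev size_map size_iota -zS eW.
have zC' : size C' = d by rewrite eC' size_rev size_map size_iota.
have scs' : all (sorted gtn) (rcons cs' C').
  rewrite -map_rcons -iW; apply/allP => _ /mapP [j _ ->].
  exact: col_word_sorted (skew_ordered ss).
rewrite !all_rcons in scs scs'.
have /andP [sC sc] := scs; have /andP [sC' sc'] := scs'.
have e1 := sumn_full_last zC pcs; have e2 := sumn_full_last zC' pcs'.
rewrite -!cats1 !flatten_cat /= !cats0 in pls plS.
(* The word of the straight tableau [T] attains the bound by its first [d] rows, and [pls] carries
   this gain to the scanned word. *)
have g : gain (nseq d 0) (flatten cs ++ C) (sumn [seq minn (size c) d | c <- cs] + d).
  apply/(plactic_gain pls); rewrite e1.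
  have := straight_gain W H (downset_box pl) (box_ordered pl hT) d.
  congr (gain _ _ (sumn _)); rewrite /col_lens -map_comp.
  apply/eq_in_map => j; rewrite mem_iota => /andP [j0 _] /=.
  by rewrite -(size_col_word _ T) box_col_word // size_map size_rev size_iota.
have : C = C'.
  apply: (last_column_unique sc sc' sC sC' zC zC' _ _ g); first by lia.
  exact: plactic_trans (plactic_sym pls) (plactic_sym plS).
rewrite eC' /C map_rev => /(can_inj revK) /eq_in_map /(_ i); rewrite mem_iota.
by move=> <- //; lia.
Qed.

Lemma word_box_height lam T W H : is_partition lam -> size lam <= H ->
  word (box lam) T W H = word (box lam) T W (size lam).
Proof.
move=> pl hH; congr flatten; apply/eq_in_map => j; rewrite mem_iota => /andP [j0 _].
by rewrite !box_col_word.
Qed.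

Lemma col_len_gt0 lam l : is_partition lam -> 0 < l <= ncols lam -> 0 < col_len lam l.
Proof.
move=> pl /andP [l0 lW]; have : box lam l 1 by rewrite /box l0.
by rewrite box_col.
Qed.

Lemma all_flatten (A : Type) (p : pred A) ss : all p (flatten ss) = all (all p) ss.
Proof. by elim: ss => //= s ss IH; rewrite all_cat IH. Qed.

(** The scanned columns, placed as a skew tableau, have a rectification with the same plactic class
    as [T]; by [straight_unique] this rectification is [T]. *)
Lemma right_key_exists n lam T l :
  is_partition lam -> semistandard n lam T -> 0 < l <= ncols lam ->
  exists S, [/\ semistandard_skew n S, rectifies_to lam T S,
    perm_eq (skew_col_lens S) (col_lens lam),
    skew_col_len S (ncols (outer S)) = col_len lam l
  & forall i, 1 <= i <= col_len lam l -> last_col S i = scan_value lam T l i].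
Proof.
move=> pl hT hl; have o := box_ordered pl hT.
have [cs [scs pcs pls]] := scan_column pl hT (leqnn _) hl.
set C := map _ _ in scs pcs pls.
have zC : size C = col_len lam l by rewrite size_map size_rev size_iota.
have C0 : 0 < size C by rewrite zC col_len_gt0.
have bnd : all (all (fun x => 1 <= x <= n)) (rcons cs C).
  rewrite -all_flatten -(perm_all _ (plactic_perm pls)) all_flatten.
  apply/allP => _ /mapP [j _ ->]; apply/allP => _ /mapP [i + ->].
  by rewrite mem_filter => /andP [/(proj1 o)].
have [S [ss eW wS lS lastS]] := skew_of_columns scs bnd C0.
have zcs : (size cs).+1 = ncols lam.
  by have := perm_size pcs; rewrite !size_map size_iota size_rcons.
rewrite zcs in eW wS; have [pi po _ _] := ss.
pose H := maxn (size lam) (size (outer S)).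
have hH : size lam <= H by exact: leq_maxl.
have hH' : size (outer S) <= H by exact: leq_maxr.
have [S' [ss' fS' nS' plS' rS']] := rectification_exists ss (fits_box po (eq_leq eW) hH').
have [_ po' _ _] := ss'.
have eS' j i : skew_box S' j i = box (outer S') j i by rewrite /skew_box nS' andbT.
have o' : ordered n (box (outer S')) (entry S').
  by case: (skew_ordered ss') => h1 h2; split=> [j i|j i j' i']; rewrite -!eS'; auto.
have pl' : plactic (word (box lam) T (ncols lam) H) (word (box (outer S')) (entry S') (ncols lam) H).
  rewrite word_box_height // -(@eq_word (skew_box S') (box (outer S')) (entry S')) //.
  by apply: plactic_trans pls _; rewrite -(wS H hH').
have uniq := straight_unique (downset_box pl) (downset_box po') o o'
  (fits_box pl (leqnn _) hH) fS' pl'.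
exists S; split=> //.
- apply: rS'; split=> // j i; first by case: (uniq j i).
  by case: (uniq j i) => _ h /h.
- by rewrite lS.
- rewrite eW -zC; have := erefl (nth 0 (skew_col_lens S) (size cs)).
  rewrite {1}/skew_col_lens eW (nth_map 0) ?size_iota -?zcs // nth_iota ?add1n // => ->.
  by rewrite lS (nth_map [::]) ?size_rcons // nth_rcons ltnn eqxx.
- move=> i hi; rewrite lastS /C map_rev revK (nth_map 0) ?size_iota; last lia.
  by rewrite nth_iota; [congr scan_value|]; lia.
Qed.

Lemma is_right_key_scan n lam T R :
  is_partition lam -> semistandard n lam T -> semistandard n lam R ->
  is_right_key n lam T R <-> forall l k, box lam l k -> R l k = scan_value lam T l k.
Proof.
move=> pl hT hR; split=> [[_ h] l k b|h].
  have [hl _] := box_bound pl b; have [S [ss rect pS zS RS]] := h l hl.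
  have hk : 1 <= k <= col_len lam l by move: b; rewrite box_col //; case/andP: hl.
  by rewrite RS //; exact: (right_key_unique pl hT hl ss rect).
split=> // l hl; have [S [ss rect pS zS lS]] := right_key_exists pl hT hl.
by exists S; split=> // i hi; rewrite lS // h // box_col //; case/andP: hl.
Qed.

(** * Keys *)

Lemma nth_subseq_leq s t k : sorted ltn t -> subseq s t -> k < size s ->
  nth 0 t k <= nth 0 s k.
Proof.
move=> srt sub hk; elim: t s k srt sub hk => [|a t IH] [|b s] [|k] //= p.
  case: eqP => [-> //|_ sub _]; apply: ltnW.
  have /allP := order_path_min ltn_trans p; apply.
  by apply: (mem_subseq sub); exact: mem_head.
case: eqP => [e sub hk|_ sub hk]; first by apply: IH => //; exact: path_sorted p.
apply: (IH s) => //; first exact: path_sorted p.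
exact: subseq_trans (subseq_cons _ _) sub.
Qed.

Lemma key_semistandard n lam (pi : n.-tuple nat) : is_partition lam ->
  size lam <= n -> is_permutation pi -> semistandard n lam (key lam pi).
Proof.
move=> pl hn [upi api].
have cn j : col_len lam j <= n by apply: leq_trans hn; exact: count_size.
have srt m : sorted ltn (sort leq (take m pi)).
  by rewrite ltn_sorted_uniq_leq sort_uniq take_uniq // sort_sorted //; exact: leq_total.
have sz j : size (sort leq (take (col_len lam j) pi)) = col_len lam j.
  by rewrite size_sort size_takel // size_tuple.
have bx j i : box lam j i -> i.-1 < col_len lam j.
  move=> b; have [/andP [j0 _] /andP [i0 _]] := box_bound pl b.
  by move: b; rewrite box_col // i0 /= prednK.
split=> j i b.
- have /allP := api; apply; apply: (@mem_take (col_len lam j)).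
  by rewrite -(mem_sort leq) mem_nth // sz bx.
- move=> b'; rewrite /key; set s := sort leq _; set s' := sort leq _.
  (* The next column of the key comes from a prefix of [pi] that is no longer, and dropping letters
     from a sorted list can only raise the entry at a given position. *)
  have sub : subseq s' s.
    apply: subseq_sort; [exact: leq_total|exact: leq_trans|].
    have le : col_len lam j.+1 <= col_len lam j by apply: sub_count => a /=; lia.
    by rewrite -(take_takel _ le); exact: take_subseq.
  by apply: nth_subseq_leq; rewrite ?srt ?sz ?bx.
- move=> b'; apply: (sorted_ltn_nth ltn_trans 0 (srt _)); rewrite ?inE ?sz ?bx //.
  by case/and3P: b => _; case: i {b'}.
Qed.

Theorem theorem10p3 (n : nat) (hn : 1 <= n)
  (lam : n.-tuple nat) (hlam : is_partition lam)
  (pi : n.-tuple nat) (hpi : in_S_lam lam pi)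
  (T : filling) (hT : semistandard n lam T) :
  exact_demazure n lam pi T <->
  (forall l k : nat, box lam l k -> T l k \in C_set n lam pi T l k).
Proof.
have hY : semistandard n lam (key lam pi).
  by apply: key_semistandard hpi.1; rewrite ?size_tuple.
(* Semistandardness places [T l k] between [k] and both neighbour bounds. With [m] for [m_U] and [Y]
   for the key entry, membership then says [T l k <= Y] if [m = Y] and [T l k = Y] if [m < Y], and
   it excludes [m > Y]: together, [maxn (T l k) m = Y]. *)
have C_iff l k : box lam l k ->
    (T l k \in C_set n lam pi T l k) = (key lam pi l k == scan_value lam T l k).
  move=> b; have [hb hr hc] := hT; have /andP [T1 Tn] := hb _ _ b.
  have [/andP [l0 lW] /andP [k0 _]] := box_bound hlam b.
  have Tk : k <= T l k.
    have dN := downset_box hlam.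
    elim: k b k0 {T1 Tn} => [//|k IH] b _; case: (posnP k) => [k0|k0].
      by rewrite k0 in b *; have /andP [] := hb _ _ b.
    have b' : box lam l k by apply: dN b _ _; lia.
    by have := IH b' k0; have := hc _ _ b' b; lia.
  have Tbelow : T l k <= below_value n lam T l k - 1.
    rewrite /below_value; case: ifP => [_|ne]; first by rewrite subSS subn0.
    have b' : box lam l k.+1 by move: b; rewrite !box_col //; lia.
    by have := hc _ _ b b'; lia.
  have Tright : T l k <= right_value n lam T l k.
    rewrite /right_value; case: ifP => [//|ne].
    by apply: hr => //; move: b; rewrite /box; lia.
  rewrite /C_set /scan_value; case: eqP => [el|_].
    (* Nothing lies to the right of the last column, so the maximum is [T l k] itself. *)
    have -> : m_U lam T l k = 1 by rewrite /m_U /bottoms el subnn.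
    by rewrite inE (maxn_idPl T1) eq_sym.
  case: ifP => [h|h]; first by rewrite inE; lia.
  case: ifP => [h'|h']; rewrite inE; lia.
rewrite /exact_demazure is_right_key_scan //.
by split=> h l k b; [rewrite C_iff // h | apply/eqP; rewrite -C_iff // h].
Qed.
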